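(* Let $\Gamma$ be a finite tree with $m\ge 1$ essential vertices. The cohomology classes $u_\sigma\in H^m(F(\Gamma,2m))$ defined in the context, where $\sigma$ runs over all permutations of $\{1,\dots,m\}$, are linearly independent. In particular, for $n\ge 2m$ the rank of the group $H^m(F(\Gamma,n))$ is at least $m!$.
   Context: An essential vertex is a vertex incident to at least 3 edges. $F(\Gamma,n)=\{(z_1,\dots,z_n)\in\Gamma^n : z_i\neq z_j\text{ for }i\neq j\}$ with the subspace topology. Cohomology has integer coefficients. Let $v_1,\dots,v_m$ be the essential vertices of $\Gamma$. For each $j$ fix a subspace $\Gamma_j\subset\Gamma$ homeomorphic to the letter $Y$ (three edges glued at one common vertex), embedded in a small neighbourhood of $v_j$ with its trivalent vertex at $v_j$, so that $\Gamma_i\cap\Gamma_j=\emptyset$ for $i\ne j$. Regard $F(\Gamma_j,2)\subset F(\Gamma,2)$; the space $F(\Gamma_j,2)$ is homotopy equivalent to the circle, so $H^1(F(\Gamma_j,2))\cong\mathbf{Z}$. For each $j=1,\dots,m$ fix a class $\alpha_j\in H^1(F(\Gamma,2))$ such that $\alpha_j|_{F(\Gamma_j,2)}\ne 0$ and $\alpha_j|_{F(\Gamma_i,2)}=0$ for all $i\ne j$ (such classes exist). For $i=1,\dots,m$ let $\Phi_i:F(\Gamma,2m)\to F(\Gamma,2)$ be the projection $\Phi_i(x_1,\dots,x_{2m})=(x_{2i-1},x_{2i})$, and put $u_{ij}=\Phi_i^*(\alpha_j)\in H^1(F(\Gamma,2m))$ for $i,j=1,\dots,m$. For a permutation $\sigma=(i_1,\dots,i_m)$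 of $\{1,\dots,m\}$ put $u_\sigma=u_{1i_1}u_{2i_2}\cdots u_{mi_m}\in H^m(F(\Gamma,2m))$ (cup-product). *)

(* Defs.v *)
From HB Require Import structures.
From mathcomp Require Import all_boot all_order all_algebra all_fingroup.
From mathcomp Require Import generic_quotient ring_quotient.
From mathcomp Require Import all_classical all_reals.
From mathcomp Require Import topology normedtype.
From mathcomp Require Import zify ring.

Set Implicit Arguments.
Unset Strict Implicit.
Unset Printing Implicit Defensive.

Import Order.TTheory GRing.Theory Num.Theory.
Import numFieldNormedType.Exports.

Local Open Scope classical_set_scope.
Local Open Scope ring_scope.
Local Open Scope quotient_scope.

Lemma continuous_to_subtype (X Y : topologicalType) (A : set Y) (f : X -> A) :
  continuous (fun x => set_val (f x)) -> continuous f.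
Proof.
move=> cf x U /= [W [[V oV <-] /= Wfx] sVU].
have /cf : nbhs (set_val (f x)) V by exact: open_nbhs_nbhs.
by rewrite nbhs_simpl /=; apply: filterS => y Vy; exact: sVU.
Qed.

Lemma continuous_to_prod (I : Type) (X Y : topologicalType)
    (f : X -> {ptws I -> Y}) :
  (forall i, continuous (fun x => f x i)) -> continuous f.
Proof.
move=> cf x; apply/cvg_sup => i U [W [[V oV <-] /= Wfx] sVU].
have /cf : nbhs (f x i) V by exact: open_nbhs_nbhs.
by rewrite !nbhs_simpl /=; apply: filterS => y Vy; exact: sVU.
Qed.

Lemma continuous_set_val (X : topologicalType) (A : set X) :
  continuous (set_val : A -> X).
Proof. exact: initial_continuous. Qed.

Lemma continuous_eval (I : eqType) (Y : topologicalType) (i : I) :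
  continuous (fun g : {ptws I -> Y} => g i).
Proof. exact: (@proj_continuous I (fun=> Y) i). Qed.

Lemma continuous_sum (R : realType) (X : topologicalType) (I : Type)
    (r : seq I) (P : pred I) (f : I -> X -> R) :
  (forall i, continuous (f i)) ->
  continuous (fun x => \sum_(i <- r | P i) f i x).
Proof.
move=> cf; elim: r => [|i r IHr].
  rewrite (_ : (fun _ => _) = cst 0); first by move=> x; exact: cvg_cst.
  by apply/funext => x; rewrite big_nil.
rewrite (_ : (fun _ => _) = fun x =>
    if P i then f i x + \sum_(j <- r | P j) f j x else
    \sum_(j <- r | P j) f j x); last by apply/funext => x; rewrite big_cons.
by case: (P i) => // x; apply: cvgD; [exact: cf | exact: IHr].
Qed.

(** The simplex spanned by a finite set [V], in barycentric coordinates; the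
    standard [n]-simplex is [Delta R 'I_n.+1]. *)
Definition simplex (R : realType) (V : finType) : set {ptws V -> R} :=
  [set x | (forall v, 0 <= x v) /\ \sum_v x v = 1].

Definition Delta (R : realType) (V : finType) : topologicalType :=
  set_type (@simplex R V).

Section Push.
Context {R : realType} {V W : finType}.
Variable th : V -> W.

Lemma push_subproof (x : Delta R V) :
  (fun w => \sum_(v | th v == w) set_val x v) \in @simplex R W.
Proof.
have [x0 x1] := set_valP x; apply/mem_set; split=> [w|].
  by apply: sumr_ge0 => v _; exact: x0.
by rewrite -x1 [RHS](partition_big th xpredT).
Qed.

(** The affine map given on vertices by [th]. *)
Definition push (x : Delta R V) : Delta R W :=
  exist (fun y => y \in @simplex R W) _ (push_subproof x).

Lemma push_continuous : continuous push.
Proof.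
apply: continuous_to_subtype; apply: continuous_to_prod => w /= x.
apply: continuous_sum => v {x} x.
apply: (@continuous_comp _ _ _ set_val (fun g : {ptws V -> R} => g v)).
  exact: continuous_set_val.
exact: continuous_eval.
Qed.

HB.instance Definition _ := @isContinuous.Build _ _ push push_continuous.

End Push.

Lemma push_comp (R : realType) (U V W : finType) (th : U -> V) (et : V -> W)
  (x : Delta R U) : push et (push th x) = push (et \o th) x.
Proof.
apply/val_inj/funext => w /=; rewrite set_valE /=.
rewrite [RHS](partition_big th (fun v => et v == w)) //=.
apply: eq_bigr => v /eqP etv; apply: eq_bigl => u.
by have [->|] := eqVneq (th u) v; rewrite ?etv ?eqxx ?andbF.
Qed.

Section SingularCohomology.
Variable R : realType.

Definition sing (n : nat) (X : topologicalType) :=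
  continuousType (Delta R 'I_n.+1) X.

Definition sing_op (X : topologicalType) k n (th : 'I_k.+1 -> 'I_n.+1)
  (s : sing n X) : sing k X := (s : Delta R 'I_n.+1 -> X) \o push th.

Lemma sing_op_comp (X : topologicalType) j k n (th : 'I_j.+1 -> 'I_k.+1)
    (et : 'I_k.+1 -> 'I_n.+1) (s : sing n X) :
  sing_op th (sing_op et s) = sing_op (et \o th) s.
Proof. by apply/continuousEP => x; rewrite /= push_comp. Qed.

Definition cochain (n : nat) (X : topologicalType) := sing n X -> int.

HB.instance Definition _ n X := GRing.Zmodule.on (cochain n X).

Definition coboundary n X (c : cochain n X) : cochain n.+1 X :=
  fun s => \sum_(i < n.+2) (-1) ^+ i * c (sing_op (lift i) s).

Definition is_coboundary n X : cochain n X -> Prop :=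
  match n with
  | 0 => fun c => c = 0
  | k.+1 => fun c => exists b : cochain k X, c = coboundary b
  end.

Lemma coboundary_is_zmod_morphism n X : zmod_morphism (@coboundary n X).
Proof.
move=> b c; apply/funext => s; rewrite /coboundary.
rewrite -[RHS]/(_ - _) -sumrB.
by apply: eq_bigr => i _; rewrite -mulrBr.
Qed.

HB.instance Definition _ n X := GRing.isZmodMorphism.Build
  (cochain n X) (cochain n.+1 X) (@coboundary n X)
  (@coboundary_is_zmod_morphism n X).

Definition cocycle_pred n X : pred (cochain n X) :=
  fun c => coboundary c == 0.

Lemma cocycle_pred_zmod_closed n X : zmod_closed (@cocycle_pred n X).
Proof.
split=> [|b c]; rewrite !unfold_in /cocycle_pred ?raddf0 //.
by move=> /eqP b0 /eqP c0; rewrite raddfB /= b0 c0 subr0.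
Qed.

HB.instance Definition _ n X := GRing.isZmodClosed.Build (cochain n X)
  (@cocycle_pred n X) (@cocycle_pred_zmod_closed n X).

Record cocycle n X := Cocycle {
  cocycle_val :> cochain n X;
  cocycle_valP : cocycle_val \in @cocycle_pred n X }.

HB.instance Definition _ n X := [isSub for @cocycle_val n X].
HB.instance Definition _ n X := [Choice of cocycle n X by <:].
HB.instance Definition _ n X :=
  [SubChoice_isSubZmodule of cocycle n X by <:].

Lemma cocycle_val_is_zmod_morphism n X : zmod_morphism (@cocycle_val n X).
Proof. by move=> b c; rewrite -[LHS]/(val (b - c)) raddfB. Qed.

HB.instance Definition _ n X := GRing.isZmodMorphism.Build
  (cocycle n X) (cochain n X) (@cocycle_val n X)
  (@cocycle_val_is_zmod_morphism n X).

Lemma cocycleP n X (c : cocycle n X) : coboundary c = 0.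
Proof. exact/eqP/(cocycle_valP c). Qed.

Definition boundary_pred n X : pred (cocycle n X) :=
  fun c => `[< is_coboundary c >].

Lemma boundary_pred_zmod_closed n X : zmod_closed (@boundary_pred n X).
Proof.
split=> [|b c]; rewrite !unfold_in /boundary_pred.
  apply/asboolP; case: n => [|n]; first exact: (raddf0 (@cocycle_val 0 X)).
  by exists 0; rewrite !raddf0.
move=> /asboolP hb /asboolP hc; apply/asboolP; rewrite raddfB.
case: n b c hb hc => [|n] b c; first by move=> /= -> ->; rewrite subr0.
by case=> b' hb [c' hc]; exists (b' - c'); rewrite raddfB /= hb hc.
Qed.

HB.instance Definition _ n X := GRing.isZmodClosed.Build (cocycle n X)
  (@boundary_pred n X) (@boundary_pred_zmod_closed n X).

Definition cohomology (n : nat) (X : topologicalType) :=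
  {ideal_quot (GRing.ZmodClosed.clone _ (@boundary_pred n X) _)}.

HB.instance Definition _ n X := GRing.Zmodule.on (cohomology n X).

Definition cls n X (c : cocycle n X) : cohomology n X :=
  \pi_(cohomology n X) c.

Lemma cls_is_zmod_morphism n X : zmod_morphism (@cls n X).
Proof. by move=> b c; rewrite /cls raddfB. Qed.

HB.instance Definition _ n X := GRing.isZmodMorphism.Build
  (cocycle n X) (cohomology n X) (@cls n X) (@cls_is_zmod_morphism n X).

Lemma cls_eq0 n X (c : cocycle n X) : cls c = 0 <-> is_coboundary c.
Proof.
split=> [/eqP|cb]; last apply/eqP; rewrite -(raddf0 (@cls n X)) /cls.
  by rewrite -Quotient.idealrBE subr0 => /asboolP.
by rewrite -Quotient.idealrBE subr0; apply/asboolP.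
Qed.

Lemma cls_repr n X (a : cohomology n X) : cls (repr a) = a.
Proof. exact: reprK. Qed.

Lemma repr_cls n X (c : cocycle n X) :
  is_coboundary (cocycle_val (repr (cls c)) - cocycle_val c).
Proof. by rewrite -raddfB; apply/cls_eq0; rewrite raddfB /= cls_repr subrr. Qed.

Section Pullback.
Context {X Y : topologicalType}.
Variable f : continuousType X Y.

Definition cochain_pull n (c : cochain n Y) : cochain n X :=
  fun s => c ((f : X -> Y) \o s).

Lemma coboundary_pull n (c : cochain n Y) :
  coboundary (cochain_pull c) = cochain_pull (coboundary c).
Proof.
apply/funext => s; apply: eq_bigr => i _; congr (_ * c _).
exact/continuousEP.
Qed.

Lemma cochain_pull_is_zmod_morphism n : zmod_morphism (@cochain_pull n).
Proof. by []. Qed.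

HB.instance Definition _ n := GRing.isZmodMorphism.Build
  (cochain n Y) (cochain n X) (@cochain_pull n)
  (@cochain_pull_is_zmod_morphism n).

Lemma cocycle_pull_subproof n (c : cocycle n Y) :
  cochain_pull c \in @cocycle_pred n X.
Proof. by apply/eqP; rewrite coboundary_pull cocycleP raddf0. Qed.

Definition cocycle_pull n (c : cocycle n Y) : cocycle n X :=
  Cocycle (cocycle_pull_subproof c).

(** Independent of the chosen representative by [pullbackE]. *)
Definition pullback n (a : cohomology n Y) : cohomology n X :=
  cls (cocycle_pull (repr a)).

Lemma is_coboundary_pull n (c : cochain n Y) :
  is_coboundary c -> is_coboundary (cochain_pull c).
Proof.
case: n c => [|n] c /= => [->|[b ->]]; first exact: raddf0.
by exists (cochain_pull b); rewrite coboundary_pull.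
Qed.

Lemma pullbackE n (c : cocycle n Y) :
  pullback (cls c) = cls (cocycle_pull c).
Proof.
apply/eqP; rewrite -subr_eq0 -raddfB; apply/eqP/cls_eq0.
by rewrite raddfB /= -raddfB; apply/is_coboundary_pull/repr_cls.
Qed.

End Pullback.

Section Cup.
Context {X : topologicalType}.

(** Used for [k <= n] only, where [inord] does not truncate. *)
Definition front k n : 'I_k.+1 -> 'I_n.+1 := fun i => inord i.
Definition back k n : 'I_k.+1 -> 'I_n.+1 := fun i => inord (n - k + i).

(** The cup product of cochains when [n = p + q]; leaving [n] free avoids
    casts between [p + q.+1] and [(p + q).+1]. *)
Definition cochain_cup n p q (b : cochain p X) (c : cochain q X) :
    cochain n X :=
  fun s => b (sing_op (@front p n) s) * c (sing_op (@back q n) s).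
Arguments cochain_cup n {p q} b c.

Lemma coboundary_cup p q (b : cochain p X) (c : cochain q X)
    (s : sing (p + q).+1 X) :
  coboundary (cochain_cup (p + q)%N b c) s =
  cochain_cup (p + q).+1 (coboundary b) c s +
  (-1) ^+ p * cochain_cup (p + q).+1 b (coboundary c) s.
Proof.
pose op k (g : nat -> nat) : sing k X :=
  sing_op (fun a : 'I_k.+1 => inord (g a) : 'I_(p + q).+2) s.
have opE k g g' : (forall a, (a <= k)%N -> g a = g' a) -> op k g = op k g'.
  move=> gg'; congr sing_op; apply/funext => a.
  by rewrite gg' // -ltnS.
have op_opE k l g (h : 'I_k.+1 -> 'I_l.+1) (h' : nat -> nat) :
    (forall a, h a = h' a :> nat) ->
    sing_op h (op l g) = op k (fun a => g (h' a)).
  by move=> hh'; rewrite sing_op_comp; congr sing_op; apply/funext => a /=;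
    rewrite hh'.
have opI k (h : 'I_k.+1 -> 'I_(p + q).+2) (h' : nat -> nat) :
    (forall a, h a = h' a :> nat) -> sing_op h s = op k h'.
  by move=> hh'; congr sing_op; apply/funext => a; rewrite -hh' inord_val.
pose A i : int := (-1) ^+ i *
  (b (op p (bump i)) * c (op q (fun a => bump i (p + a)))).
pose B i : int := (-1) ^+ i *
  (b (op p (bump i)) * c (op q (fun a => (p + a).+1))).
pose C j : int := (-1) ^+ (p + j)%N *
  (b (op p id) * c (op q (fun a => (p + bump j a)%N))).
have frontE k n (a : 'I_k.+1) : (k <= n)%N -> @front k n a = a :> nat.
  by move=> kn; rewrite /front inordK // (leq_trans (ltn_ord a)).
have backE k l n (a : 'I_k.+1) : n = (l + k)%N ->
    @back k n a = (l + a)%N :> nat.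
  by move=> ->; rewrite /back addnK inordK // ltnS leq_add2l -ltnS.
have -> : coboundary (cochain_cup (p + q)%N b c) s =
    \sum_(0 <= i < (p + q).+2) A i.
  rewrite big_mkord; apply: eq_bigr => i _; rewrite /cochain_cup /A.
  have -> : sing_op (lift i) s = op _ (bump i) by exact: opI.
  have -> g : sing_op (@front p (p + q)) (op (p + q)%N g) = op p g.
    by apply: (op_opE _ _ _ _ id) => a; rewrite frontE // leq_addr.
  by rewrite (op_opE _ _ _ _ (addn p)) // => a; rewrite (backE _ p).
have -> : cochain_cup (p + q).+1 (coboundary b) c s =
    \sum_(0 <= i < p.+2) B i.
  rewrite big_mkord /cochain_cup big_distrl; apply: eq_bigr => i _ /=.
  rewrite /B -mulrA.
  have -> : sing_op (@front p.+1 (p + q).+1) s = op _ id.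
    by apply: opI => a; rewrite frontE // ltnS leq_addr.
  have -> : sing_op (lift i) (op p.+1 id) = op p (bump i) by exact: op_opE.
  have -> // : sing_op (@back q (p + q).+1) s = op q (fun a => (p + a).+1).
  by apply: opI => a; rewrite (backE _ p.+1).
have -> : (-1) ^+ p * cochain_cup (p + q).+1 b (coboundary c) s =
    \sum_(0 <= j < q.+2) C j.
  rewrite big_mkord /cochain_cup !big_distrr; apply: eq_bigr => j _ /=.
  rewrite /C exprD -mulrA; congr (_ * _); rewrite mulrCA; congr (_ * _).
  have -> : sing_op (@front p (p + q).+1) s = op _ id.
    by apply: opI => a; rewrite frontE // leqW // leq_addr.
  have -> : sing_op (@back q.+1 (p + q).+1) s = op q.+1 (addn p).
    by apply: opI => a; rewrite (backE _ p) // addnS.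
  by congr (_ * c _); exact: op_opE.
rewrite (@big_cat_nat _ _ _ p.+1) //=; last by rewrite ltnS leqW // leq_addr.
rewrite (big_nat_recr p.+1) //= (big_nat_recl q.+1) //=.
have BC : B p.+1 + C 0%N = 0.
  rewrite /B /C addn0 exprS mulN1r mulNr addrC; apply/eqP; rewrite subr_eq0.
  apply/eqP; congr (_ * (b _ * c _)); apply: opE => x x_le.
    by rewrite /bump ltnNge x_le.
  by rewrite /bump /= addnA addn1.
rewrite -[RHS]addrA [X in _ = _ + X]addrA BC add0r; congr (_ + _).
  apply: eq_big_nat => i /andP[_ ip]; congr (_ * (_ * c _)); apply: opE => x _.
  by rewrite /bump -addSn (leq_trans _ (leq_addr _ _)) ?(ltnW ip).
rewrite -{1}[p.+1]add0n big_addn -addnS -addSn addKn.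
apply: eq_big_nat => j _; rewrite /A /C addnC addSnnS.
congr (_ * (b _ * c _)); apply: opE => x x_le.
  by rewrite /bump leqNgt addnS ltnS (leq_trans x_le) ?leq_addr.
by rewrite /bump leq_add2l addnCA.
Qed.

Lemma cocycle_cup_subproof p q (b : cocycle p X) (c : cocycle q X) :
  cochain_cup (p + q) b c \in @cocycle_pred (p + q) X.
Proof.
apply/eqP/funext => s; rewrite coboundary_cup /cochain_cup !cocycleP.
by rewrite mul0r mulr0 mulr0 addr0.
Qed.

Definition cocycle_cup p q (b : cocycle p X) (c : cocycle q X) :
  cocycle (p + q) X := Cocycle (cocycle_cup_subproof b c).

(** Independent of the chosen representatives by [cupE]. *)
Definition cup p q (a : cohomology p X) (b : cohomology q X) :
  cohomology (p + q) X := cls (cocycle_cup (repr a) (repr b)).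

Lemma is_coboundary_cupl p q (b : cochain p X) (c : cochain q X) :
  is_coboundary b -> coboundary c = 0 -> is_coboundary (cochain_cup (p + q) b c).
Proof.
case: p b => [|p] b /= => [->|[b' ->]] c0.
  suff -> : cochain_cup q (0 : cochain 0 X) c = 0.
    by case: (q) => [|k] //=; exists 0; rewrite raddf0.
  by apply/funext => s; rewrite /cochain_cup mul0r.
exists (cochain_cup (p + q) b' c); apply/funext => s.
by rewrite coboundary_cup c0 /cochain_cup mulr0 mulr0 addr0.
Qed.

Lemma is_coboundary_cupr p q (b : cochain p X) (c : cochain q X) :
  coboundary b = 0 -> is_coboundary c -> is_coboundary (cochain_cup (p + q) b c).
Proof.
case: q c => [|q] c b0 /= => [->|[c' ->]].
  suff -> : cochain_cup (p + 0) b (0 : cochain 0 X) = 0.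
    by case: (p + 0)%N => [|k] //=; exists 0; rewrite raddf0.
  by apply/funext => s; rewrite /cochain_cup mulr0.
suff cupb n : n = (p + q).+1 ->
  is_coboundary (cochain_cup n b (coboundary c')) by apply: cupb; rewrite addnS.
move=> -> /=; set d := cochain_cup (p + q) b c'.
have dE s : coboundary d s =
    (-1) ^+ p * cochain_cup (p + q).+1 b (coboundary c') s.
  by rewrite coboundary_cup b0 {1}/cochain_cup mul0r add0r.
case: (boolP (odd p)) => op; [exists (- d) | exists d]; apply/funext => s.
  by rewrite raddfN -[RHS]/(- coboundary d s) dE -signr_odd op mulN1r opprK.
by rewrite dE -signr_odd (negbTE op) mul1r.
Qed.

Lemma cupE p q (b : cocycle p X) (c : cocycle q X) :
  cup (cls b) (cls c) = cls (cocycle_cup b c).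
Proof.
rewrite /cup; set b' := repr _; set c' := repr _.
apply/eqP; rewrite -subr_eq0 -raddfB; apply/eqP/cls_eq0; rewrite raddfB /=.
have -> : cochain_cup (p + q) b' c' - cochain_cup (p + q) b c =
    (cocycle_cup (b' - b) c' : cochain _ X) +
    (cocycle_cup b (c' - c) : cochain _ X).
  apply/funext => s; rewrite -[LHS]/(_ s - _ s) -[RHS]/(_ s + _ s).
  rewrite /cochain_cup.
  have valB k (u v : cocycle k X) t :
    cocycle_val (u - v) t = cocycle_val u t - cocycle_val v t by [].
  rewrite -[X in _ = X + _]/(cocycle_val (b' - b) _ * cocycle_val c' _).
  rewrite -[X in _ = _ + X]/(cocycle_val b _ * cocycle_val (c' - c) _) !valB; ring.
rewrite -raddfD; apply/cls_eq0; rewrite raddfD /=.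
have -> : cls (cocycle_cup (b' - b) c') = 0.
  apply/cls_eq0/is_coboundary_cupl; last exact: cocycleP.
  by rewrite raddfB; exact: repr_cls.
have -> : cls (cocycle_cup b (c' - c)) = 0; last by rewrite addr0.
apply/cls_eq0/is_coboundary_cupr; first exact: cocycleP.
by rewrite raddfB; exact: repr_cls.
Qed.

End Cup.

Lemma cochain_one_subproof X :
  (fun=> 1) \in @cocycle_pred 0 X.
Proof.
apply/eqP/funext => s; rewrite /coboundary !big_ord_recl big_ord0.
by rewrite expr0 expr1 !mulr1 addr0 subrr.
Qed.

Definition cohomology_one X : cohomology 0 X :=
  cls (Cocycle (@cochain_one_subproof X)).

(** [a_0 (a_1 ( ... (a_(k-1) 1)))] *)
Fixpoint cup_prod X k : ('I_k -> cohomology 1 X) -> cohomology k X :=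
  match k with
  | 0 => fun _ => cohomology_one X
  | j.+1 => fun a => cup (a ord0) (cup_prod (fun i => a (lift ord0 i)))
  end.

End SingularCohomology.

Definition Z_independent (A : zmodType) (I : finType) (u : I -> A) : Prop :=
  forall c : I -> int, \sum_i u i *~ c i = 0 -> forall i, c i = 0.

(** The rank is the largest size of a linearly independent family. *)
Definition rank_at_least (A : zmodType) (r : nat) : Prop :=
  exists u : 'I_r -> A, Z_independent u.

Definition Conf (X : topologicalType) (n : nat) : topologicalType :=
  set_type [set z : {ptws 'I_n -> X} | injective z].

Section ConfMaps.
Variables (X Y : topologicalType).

Section Forget.
Variables (k n : nat) (th : 'I_k -> 'I_n).
Hypothesis th_inj : injective th.

Lemma conf_forget_subproof (z : Conf X n) :
  (set_val z : 'I_n -> X) \o th \in [set z : {ptws 'I_k -> X} | injective z].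
Proof. by apply/mem_set => i j /(set_valP z)/th_inj. Qed.

Definition conf_forget (z : Conf X n) : Conf X k :=
  exist (fun y => y \in [set z : {ptws 'I_k -> X} | injective z]) _
    (conf_forget_subproof z).

Lemma conf_forget_continuous : continuous conf_forget.
Proof.
apply: continuous_to_subtype; apply: continuous_to_prod => i /= z.
apply: (@continuous_comp _ _ _ set_val (fun g : {ptws 'I_n -> X} => g (th i))).
  exact: continuous_set_val.
exact: continuous_eval.
Qed.

HB.instance Definition _ :=
  @isContinuous.Build _ _ conf_forget conf_forget_continuous.
End Forget.

Section Map.
Variables (n : nat) (f : continuousType X Y).
Hypothesis f_inj : injective f.

Lemma conf_map_subproof (z : Conf X n) :
  f \o (set_val z : 'I_n -> X) \in [set z : {ptws 'I_n -> Y} | injective z].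
Proof. by apply/mem_set => i j /f_inj/(set_valP z). Qed.

Definition conf_map (z : Conf X n) : Conf Y n :=
  exist (fun y => y \in [set z : {ptws 'I_n -> Y} | injective z]) _
    (conf_map_subproof z).

Lemma conf_map_continuous : continuous conf_map.
Proof.
apply: continuous_to_subtype; apply: continuous_to_prod => i /= z.
apply: (@continuous_comp _ _ _ _ f); last exact: cts_fun.
apply: (@continuous_comp _ _ _ set_val (fun g : {ptws 'I_n -> X} => g i)).
  exact: continuous_set_val.
exact: continuous_eval.
Qed.

HB.instance Definition _ :=
  @isContinuous.Build _ _ conf_map conf_map_continuous.
End Map.

End ConfMaps.

HB.instance Definition _ (X : topologicalType) (A : set X) :=
  @isContinuous.Build A X set_val (@continuous_set_val X A).

Lemma set_val_inj (X : Type) (A : set X) : injective (set_val : A -> X).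
Proof. by rewrite set_valE; exact: val_inj. Qed.

Definition conf_incl (X : topologicalType) (A : set X) (n : nat) :
    continuousType (Conf A n) (Conf X n) :=
  @conf_map A X n set_val (@set_val_inj X A).

Lemma pair_index_subproof m (i : 'I_m) (k : 'I_2) : (2 * i + k < 2 * m)%N.
Proof. have := ltn_ord i; have := ltn_ord k; lia. Qed.

Definition pair_index m (i : 'I_m) (k : 'I_2) : 'I_(2 * m) :=
  Ordinal (pair_index_subproof i k).

Lemma pair_index_inj m (i : 'I_m) : injective (pair_index i).
Proof. by move=> k l /(congr1 val) /= /addnI /val_inj. Qed.

(** [(x_0, ..., x_(2m-1)) |-> (x_(2i), x_(2i+1))], with 0-based indices. *)
Definition Phi (X : topologicalType) m (i : 'I_m) :
    continuousType (Conf X (2 * m)) (Conf X 2) :=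
  @conf_forget X 2 (2 * m) _ (@pair_index_inj m i).

Definition simple_graph (V : finType) (e : rel V) : Prop :=
  symmetric e /\ irreflexive e.

(** Since [e] is symmetric, [a; b] is a [ucycle] for each edge [a b]; the
    circuits of the graph are the [ucycle]s of size at least 3. *)
Definition is_tree (V : finType) (e : rel V) : Prop :=
  [/\ simple_graph e, forall a b, connect e a b
    & forall p : seq V, ucycle e p -> (size p <= 2)%N].

Definition essential (V : finType) (e : rel V) (a : V) : bool :=
  (3 <= #|[pred b | e a b]|)%N.

Section Realization.
Variables (R : realType) (V : finType) (e : rel V).

(** The points of the simplex on [V] supported on a vertex or an edge. *)
Definition realization_set : set {ptws V -> R} :=
  [set x | simplex x /\
    exists a b : V, (a = b \/ e a b) /\
      forall w, x w != 0 -> (w == a) || (w == b)].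

Definition realization : topologicalType := set_type realization_set.

Lemma vertex_subproof (a : V) : (fun w : V => (w == a)%:R) \in realization_set.
Proof.
apply/mem_set; split; first split.
- by move=> w; exact: ler0n.
- by rewrite (bigD1 a) //= eqxx big1 ?addr0 // => w /negbTE ->.
- exists a, a; split; first by left.
  by move=> w; case: (w == a) => //; rewrite eqxx.
Qed.

Definition vertex (a : V) : realization :=
  exist (fun y => y \in realization_set) _ (vertex_subproof a).

(** The vertex [a] together with the interiors of the edges incident to it. *)
Definition open_star (a : V) : set realization :=
  [set x : realization | 0 < set_val x a].

End Realization.

(** The star with centre [None] and three leaves, whose realization is the
    letter Y. *)
Definition star3 : rel (option 'I_3) := fun a b => isSome a != isSome b.

Definition letterY (R : realType) : topologicalType := realization R star3.

Definition is_Y_at (R : realType) (V : finType) (e : rel V) (a : V)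
    (A : set (realization R e)) : Prop :=
  A `<=` open_star a /\
  exists (h : continuousType (letterY R) A) (g : continuousType A (letterY R)),
    [/\ cancel h g, cancel g h
      & set_val (h (vertex R star3 None)) = vertex R e a].

(* Main.v *)
From HB Require Import structures.
Require Import Defs.
From mathcomp Require Import all_boot all_order all_algebra all_fingroup.
From mathcomp Require Import all_classical all_reals topology normedtype.
From mathcomp Require Import generic_quotient.
From mathcomp Require Import interval_inference zify ring lra.

(** The products are shown to be independent by evaluating them on tori. For a
    permutation [t], let the points [2 i] and [2 i + 1] move along a loop of
    configurations in the set [Y (t i)], independently for all [i]; since these
    sets are disjoint, this is a map from an [m]-dimensional torus to the
    configuration space. The [i]-th factor of the product indexed by [s] sees
    only the [i]-th loop, where it takes the value of [alpha (s i)] on a loop in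
    [Y (t i)]. This is zero if [s i] differs from [t i], so the product of [s]
    evaluates to zero on the torus of [t] unless [s = t]; if the loops are
    chosen suitably, it evaluates to a nonzero integer when [s = t]. This is
    [cup_products_independent].

    The argument rests on three facts about singular cochains. First, a cocycle
    of degree one that vanishes on all loops is a coboundary ([loops_detect]),
    so each nonzero restriction of [alpha j] is nonzero on some loop. Second,
    the sum of the [m!] simplices of the standard triangulation of the cube,
    with signs, becomes a cycle on the torus ([torus_period_coboundary]), so
    evaluation on it is well defined on cohomology classes. Third, on such a
    simplex a product of classes of degree one is the product of the values of
    the factors on the successive edges ([cup_prodE]); the [i]-th coordinate
    moves along a single edge, so only the simplex of the identity permutation
    contributes ([torus_period_prod]).

    For the bound on the rank, classes [alpha j] have to be produced. At an
    essential vertex, choose neighbours [b1], [b2], [b3]. The ratio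
    [h1 / (h1 + h2)], where [h1] measures how far the first point is in the
    branch of [b1] and [h2] how far the second one is in the branch of [b2], is
    continuous modulo 1 on configurations of two points, because the two heights
    can vanish together without vanishing nearby only if both points are at the
    vertex. Lifting it along paths to the real line gives an integral cocycle
    ([winding_cocycle]). Around another vertex the ratio is 0 or 1, because that
    vertex is outside one of the two branches, which are disjoint in a tree
    ([angle_class_eq0]); and on the loop in which two points chase each other
    around the tripod of [b1], [b2], [b3] it winds once
    ([angle_class_neq0]). The remaining points of the configuration rest in the
    middle of an edge ([far_points]). *)

Set Implicit Arguments.
Unset Strict Implicit.
Unset Printing Implicit Defensive.

Import Order.TTheory GRing.Theory Num.Theory.
Import numFieldNormedType.Exports.
Local Open Scope classical_set_scope.
Local Open Scope ring_scope.

(** * Continuous functions *)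

Section RealFunctions.
Context {R : realType} {X : topologicalType}.
Variables f g : X -> R.
Hypotheses (cf : continuous f) (cg : continuous g).

Lemma continuous_add : continuous (fun x => f x + g x).
Proof. by move=> x; apply: cvgD; [exact: cf | exact: cg]. Qed.

Lemma continuous_sub : continuous (fun x => f x - g x).
Proof. by move=> x; apply: cvgB; [exact: cf | exact: cg]. Qed.

Lemma continuous_mul : continuous (fun x => f x * g x).
Proof. by move=> x; apply: cvgM; [exact: cf | exact: cg]. Qed.

Lemma continuous_div : (forall x, g x != 0) -> continuous (fun x => f x / g x).
Proof. by move=> g0 x; apply: cvgM; [exact: cf | apply: cvgV => //; exact: cg]. Qed.

End RealFunctions.

Lemma continuous_pair (X Y Z : topologicalType) (f : X -> Y) (g : X -> Z) :
  continuous f -> continuous g -> continuous (fun x => (f x, g x)).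
Proof.
move=> cf cg x; apply: (@cvg_pair _ _ _ _ (nbhs (f x)) (nbhs (g x)) _ _ _ f g).
  exact: cf.
exact: cg.
Qed.

Lemma continuous_paste (R : realType) (X Y : topologicalType) (p : X -> R)
    (f g : X -> Y) :
  continuous p -> continuous f -> continuous g ->
  (forall x, p x = 0 -> f x = g x) ->
  continuous (fun x => if p x <= 0 then f x else g x).
Proof.
move=> cp cf cg fg x; rewrite /continuous_at; case: (ltgtP (p x) 0) => px /=.
- apply: (@cvg_trans _ (f y @[y --> x])); last exact: cf.
  apply: (@near_eq_cvg _ _ (nbhs x)); have H := cvgr_lt _ (cp x) 0 px.
  by apply: (@filterS _ (nbhs x)) (H _) => y /ltW ->.
- apply: (@cvg_trans _ (g y @[y --> x])); last exact: cg.
  apply: (@near_eq_cvg _ _ (nbhs x)); have H := cvgr_gt _ (cp x) 0 px.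
  by apply: (@filterS _ (nbhs x)) (H _) => y; rewrite ltNge => /negbTE ->.
- move=> U /= Ux; rewrite nbhs_simpl /=.
  have Uf : \forall y \near x, U (f y) by exact: (cf x U Ux).
  have Ug : \forall y \near x, U (g y).
    by apply: (cg x U); rewrite -(fg x px).
  by apply: filterS2 Uf Ug => y Ufy Ugy /=; case: (_ <= _).
Qed.

(** * Simplices *)

Lemma bary_continuous (R : realType) (V : finType) (w : V) :
  continuous (fun x : Delta R V => set_val x w).
Proof.
move=> x; apply: (@continuous_comp _ _ _ set_val (fun g : {ptws V -> R} => g w)).
  exact: continuous_set_val.
exact: continuous_eval.
Qed.

Section Simplex.
Context {R : realType}.

Lemma push_inj_coord (V W : finType) (th : V -> W) (x : Delta R V) v :
  injective th -> set_val (push th x) (th v) = set_val x v.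
Proof.
by move=> th_inj; rewrite {1}set_valE /= (big_pred1 v) // => u; rewrite (inj_eq th_inj).
Qed.

Lemma push_coord0 (V W : finType) (th : V -> W) (x : Delta R V) w :
  (forall v, th v != w) -> set_val (push th x) w = 0.
Proof. by move=> thw; rewrite set_valE /= big_pred0 // => u; apply/negbTE. Qed.

Lemma Delta2_coord0 (y : Delta R 'I_2) :
  set_val y ord0 = 1 - set_val y ord_max.
Proof.
have [_ <-] := set_valP y; rewrite !big_ord_recl !big_ord0 addr0 /=.
by rewrite (_ : lift ord0 ord0 = ord_max) ?addrK //; apply/val_inj.
Qed.

Lemma Delta_bounds (V : finType) (x : Delta R V) w : 0 <= set_val x w <= 1.
Proof.
have [x0 x1] := set_valP x; rewrite x0 /= -x1 (bigD1 w) //= lerDl.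
by apply: sumr_ge0 => i _; exact: x0.
Qed.

Definition clamp (u : R) : R := Num.max 0 (Num.min 1 u).

Lemma clamp_bounds u : 0 <= clamp u <= 1.
Proof. by rewrite /clamp le_max lexx /= ge_max ler01 /= ge_min lexx. Qed.

Lemma clamp_id u : 0 <= u <= 1 -> clamp u = u.
Proof. by move=> /andP[u0 u1]; rewrite /clamp min_r // max_r. Qed.

Lemma clamp_continuous : continuous clamp.
Proof.
move=> u; apply: (@continuous_max _ R (fun=> 0) (fun u => Num.min 1 u)).
  exact: cvg_cst.
apply: (@continuous_min _ R (fun=> 1) id); last exact: cvg_id.
exact: cvg_cst.
Qed.

Lemma seg_subproof (u : R) :
  (fun i : 'I_2 => if i == ord0 then 1 - clamp u else clamp u) \in @simplex R 'I_2.
Proof.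
have /andP[u0 u1] := clamp_bounds u; apply/mem_set; split=> [i|].
  by case: ifP => _ //; rewrite subr_ge0.
by rewrite !big_ord_recl big_ord0 /= addr0 subrK.
Qed.

(** The point of the edge at distance [u] from its initial vertex. The
    parameter is clamped to make [seg] total, which keeps every path built
    from it a plain composition of continuous maps. *)
Definition seg (u : R) : Delta R 'I_2 :=
  exist (fun y => y \in @simplex R 'I_2) _ (seg_subproof u).

Lemma seg_continuous : continuous seg.
Proof.
apply: continuous_to_subtype; apply: continuous_to_prod => i /=.
have -> : (fun u => set_val (seg u) i) =
    fun u => if i == ord0 then 1 - clamp u else clamp u by [].
case: (i == ord0) => u; last exact: clamp_continuous.
by apply: cvgB; [exact: cvg_cst | exact: clamp_continuous].
Qed.

Lemma segK (y : Delta R 'I_2) : seg (set_val y ord_max) = y.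
Proof.
apply/val_inj/funext => i /=; rewrite clamp_id ?Delta_bounds //.
case: eqP => [->|/eqP i0]; first by rewrite -Delta2_coord0 set_valE.
by rewrite set_valE; congr (val y _); apply/val_inj; case: i i0 => [[|[|]]].
Qed.

Lemma seg0 (z : Delta R 'I_1) : seg 0 = push (lift ord_max) z.
Proof.
rewrite -[RHS]segK; congr seg; rewrite push_coord0 // => v.
by rewrite eq_sym neq_lift.
Qed.

Lemma seg1 (z : Delta R 'I_1) : seg 1 = push (lift ord0) z.
Proof.
rewrite -[RHS]segK; congr seg.
have -> : ord_max = lift ord0 ord0 :> 'I_2 by apply/val_inj.
rewrite push_inj_coord; last exact: lift_inj.
by have [_ <-] := set_valP z; rewrite big_ord_recl big_ord0 addr0.
Qed.

End Simplex.

(** * Cocycles of degree one *)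

Section Paths.
Context {R : realType} {X : topologicalType}.
Implicit Types (s t w : sing R 1 X) (c : cochain R 1 X).

(** The end points of a path are taken as 0-simplices, so that they can be
    fed to cochains and compared without choosing the point of the
    0-simplex. *)
Definition source s : sing R 0 X := sing_op (lift ord_max) s.
Definition target s : sing R 0 X := sing_op (lift ord0) s.

Definition const_path (a : sing R 0 X) : sing R 1 X := sing_op (fun=> ord0) a.

Lemma sing_op_const p (f g : 'I_p.+1 -> 'I_1) (a : sing R 0 X) :
  sing_op f a = sing_op g a.
Proof. by congr sing_op; apply/funext => i; rewrite !ord1. Qed.

Lemma sing_op_id p (f : 'I_p.+1 -> 'I_p.+1) (s : sing R p X) :
  f =1 id -> sing_op f s = s.
Proof.
move=> fid; apply/continuousEP => x /=; congr (s _); apply/val_inj/funext => w /=.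
rewrite set_valE /= (bigD1 w) /= ?fid // big1 ?addr0 // => i /andP[+ iw].
by rewrite fid (negbTE iw).
Qed.

Lemma coboundary1E (b : cochain R 0 X) s :
  coboundary b s = b (target s) - b (source s).
Proof.
rewrite /coboundary !big_ord_recl big_ord0 /= expr0 mul1r expr1 mulN1r addr0.
by congr (_ - b _); congr sing_op; apply/funext => i; apply/val_inj; rewrite ord1.
Qed.

Definition skip (k : nat) : 'I_2 -> 'I_3 := lift (inord k : 'I_3).

Lemma skipE k (i : 'I_2) : (k < 3)%N -> skip k i = bump k i :> nat.
Proof. by move=> k3; rewrite /skip /= inordK. Qed.

Lemma coboundary2E (c : cochain R 1 X) (s : sing R 2 X) :
  coboundary c s = c (sing_op (skip 0) s) -
    c (sing_op (skip 1) s) + c (sing_op (skip 2) s).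
Proof.
rewrite /coboundary !big_ord_recl big_ord0 /= expr0 mul1r expr1 mulN1r addr0.
have E (i : 'I_3) k : i = k :> nat -> c (sing_op (lift i) s) = c (sing_op (skip k) s).
  by move=> ik; congr (c (sing_op _ s)); rewrite /skip -ik inord_val.
by rewrite (E _ 0%N) // (E _ 1%N) // (E _ 2%N) // expr2 mulN1r opprK mul1r addrA.
Qed.

Lemma cocycle1_triangle c (s : sing R 2 X) : coboundary c = 0 ->
  c (sing_op (skip 1) s) =
  c (sing_op (skip 2) s) + c (sing_op (skip 0) s).
Proof.
move=> /(congr1 (fun f => f s)); rewrite coboundary2E.
by rewrite -[X in _ = X -> _]/(0 : int) => h; lia.
Qed.

Lemma cocycle_const c a : coboundary c = 0 -> c (const_path a) = 0.
Proof.
move=> dc; have := cocycle1_triangle (sing_op (fun=> ord0) a : sing R 2 X) dc.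
rewrite !sing_op_comp !(sing_op_const _ (fun=> ord0) a) -/(const_path a).
by move=> h; lia.
Qed.

Definition reverse_path s : sing R 1 X := sing_op (@rev_ord 2) s.

Lemma source_rev s : source (reverse_path s) = target s.
Proof.
rewrite /source /target /reverse_path sing_op_comp; congr sing_op.
by apply/funext => i; apply/val_inj; rewrite ord1.
Qed.

Lemma target_rev s : target (reverse_path s) = source s.
Proof.
rewrite /source /target /reverse_path sing_op_comp; congr sing_op.
by apply/funext => i; apply/val_inj; rewrite ord1.
Qed.

Lemma cocycle_rev c s : coboundary c = 0 -> c (reverse_path s) = - c s.
Proof.
(* The triangle with vertices s(0), s(1), s(0) that is mapped onto s has
   sides s, its reverse, and a constant path. *)
pose f (i : 'I_3) : 'I_2 := inord (i == 1%N :> nat).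
move=> dc; have := cocycle1_triangle (sing_op f s) dc; rewrite !sing_op_comp.
have -> : f \o skip 1 = (lift ord_max) \o (fun=> ord0).
  by apply/funext => i; apply/val_inj; rewrite /f /= inordK ?ltnS ?leq_b1 //
    ?inordK //; case: i => [[|[|]]].
have -> : f \o skip 2 = id.
  by apply/funext => i; apply/val_inj; rewrite /f /= inordK ?ltnS ?leq_b1 //
    ?inordK //; case: i => [[|[|]]].
have -> : f \o skip 0 = @rev_ord 2.
  by apply/funext => i; apply/val_inj; rewrite /f /= inordK ?ltnS ?leq_b1 //
    ?inordK //; case: i => [[|[|]]].
rewrite -sing_op_comp -[sing_op (lift ord_max) s]/(source s).
rewrite -[sing_op _ (source s)]/(const_path _) cocycle_const //.
by rewrite (sing_op_id (f := id)) // -/(reverse_path s) => h; lia.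
Qed.

End Paths.

Lemma inord0E : inord 0 = ord0 :> 'I_2.
Proof. by apply/ord_inj; rewrite inordK. Qed.

Lemma inord1E : inord 1 = ord_max :> 'I_2.
Proof. by apply/ord_inj; rewrite inordK. Qed.

Section Concatenation.
Context {R : realType} {X : topologicalType}.
Implicit Types (s t : sing R 1 X).

Section Triangle.
Variables (s t : sing R 1 X).

(** The triangle is projected onto the union of its edges [01] and [12] along
    the lines where [x_2 - x_0] is constant, and then mapped by [s] and [t]. *)
Definition bend (x : Delta R 'I_3) : X :=
  let d := set_val x (inord 2) - set_val x (inord 0) in
  if d <= 0 then s (seg (1 + d)) else t (seg d).

Hypothesis st : target s = source t.

Lemma target_seg (s' : sing R 1 X) : s' (seg 1) = target s' (push (fun=> ord0) (seg 0)).
Proof. by rewrite /target /= -seg1. Qed.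

Lemma source_seg (s' : sing R 1 X) : s' (seg 0) = source s' (push (fun=> ord0) (seg 0)).
Proof. by rewrite /source /= -seg0. Qed.

Lemma bend_continuous : continuous bend.
Proof.
pose d (x : Delta R 'I_3) := set_val x (inord 2) - set_val x (inord 0).
have cd : continuous d by apply: continuous_sub; exact: bary_continuous.
apply: (@continuous_paste R _ _ d (fun x => s (seg (1 + d x))) (fun x => t (seg (d x)))).
- exact: cd.
- move=> x; apply: (@continuous_comp _ _ _ (fun x => 1 + d x) (s \o seg)).
    by apply: (continuous_add _ cd) ; exact: cst_continuous.
  by apply: (@continuous_comp _ _ _ seg s); [exact: seg_continuous | exact: cts_fun].
- move=> x; apply: (@continuous_comp _ _ _ d (t \o seg)); first exact: cd.
  by apply: (@continuous_comp _ _ _ seg t); [exact: seg_continuous | exact: cts_fun].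
- by move=> x ->; rewrite addr0 target_seg source_seg st.
Qed.

Definition triangle : sing R 2 X := mkcts bend_continuous.

Lemma skip_coord k (y : Delta R 'I_2) j : (k < 3)%N -> (j < 2)%N ->
  set_val (push (skip k) y) (inord (bump k j)) = set_val y (inord j).
Proof.
move=> k3 j2; have -> : inord (bump k j) = skip k (inord j).
  apply: ord_inj; rewrite skipE // !inordK //.
  by rewrite /bump; lia.
by rewrite push_inj_coord //; exact: lift_inj.
Qed.

Lemma skip_coord0 k (y : Delta R 'I_2) : set_val (push (skip k) y) (inord k) = 0.
Proof. by apply: push_coord0 => v; rewrite /skip eq_sym neq_lift. Qed.

Lemma triangle_skip2 : sing_op (skip 2) triangle = s.
Proof.
apply/continuousEP => y; rewrite /= /mkcts /bend skip_coord0 sub0r.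
rewrite (@skip_coord 2 y 0) // inord0E Delta2_coord0 opprB addrCA subrr addr0 segK.
by rewrite subr_le0; have /andP[_ ->] := Delta_bounds y ord_max.
Qed.

Lemma triangle_skip0 : sing_op (skip 0) triangle = t.
Proof.
apply/continuousEP => y; rewrite /= /mkcts /bend skip_coord0 subr0.
rewrite (@skip_coord 0 y 1) // inord1E segK.
have /andP[y0 _] := Delta_bounds y ord_max; case: ifP => // yle.
have {yle y0} y0 : set_val y ord_max = 0 by apply/eqP; rewrite eq_le yle.
by rewrite -[in RHS](segK y) y0 addr0 target_seg source_seg st.
Qed.

End Triangle.

(** The paths [s] and [t] are concatenated along the third edge of the triangle
    that they bound; on a cocycle, the concatenation then has the value
    [c s + c t] by the very cocycle condition. *)
Lemma concat s t : target s = source t ->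
  exists w, [/\ source w = source s, target w = target t &
    forall c : cochain R 1 X, coboundary c = 0 -> c w = c s + c t].
Proof.
move=> st; exists (sing_op (skip 1) (triangle st)); split.
- rewrite -[in RHS](triangle_skip2 st) /source !sing_op_comp; congr sing_op.
  apply/funext => i; apply/val_inj; rewrite /= ord1 !inordK //.
- rewrite -[in RHS](triangle_skip0 st) /target !sing_op_comp; congr sing_op.
  by apply/funext => i; apply/val_inj; rewrite /= ord1 !inordK.
- move=> c dc; have := cocycle1_triangle (triangle st) dc.
  by rewrite triangle_skip2 triangle_skip0.
Qed.

(** Choose a base point in each path component, and a path to each point from
    the base point of its component. The values of the cocycle on these paths
    form a primitive: for a path [s], going along the path to the source of
    [s], then [s], then back along the path to its target, is a loop. *)
Lemma loops_detect (c : cochain R 1 X) : coboundary c = 0 ->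
  (forall l, source l = target l -> c l = 0) -> is_coboundary c.
Proof.
move=> dc cl0.
pose joined a b := exists s, source s = a /\ target s = b.
have joined_refl a : joined a a.
  exists (const_path a); rewrite /source /target /const_path !sing_op_comp.
  by rewrite !sing_op_id // => i; rewrite /= !ord1.
have joined_sym a b : joined a b -> joined b a.
  by case=> s [<- <-]; exists (reverse_path s); rewrite source_rev target_rev.
have joined_trans a b d : joined a b -> joined b d -> joined a d.
  case=> s [<- sb] [t [tb <-]]; have [|w [ws wt _]] := @concat s t.
    by rewrite sb tb.
  by exists w.
pose base a := sval (cid (ex_intro _ a (joined_refl a) : exists b, joined a b)).
have baseP a : joined a (base a) by rewrite /base; case: cid.
(* Equal components have the same base point, because [cid] is applied to
   equal predicates, with proofs that are equal by proof irrelevance. *)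
have base_eq a b : joined a b -> base a = base b.
  move=> ab; rewrite /base; have : joined a = joined b.
    apply/funext => d; apply/propext; split => [ad|bd].
      exact: joined_trans (joined_sym _ _ ab) ad.
    exact: joined_trans ab bd.
  move: (ex_intro _ a _) (ex_intro _ b _); rewrite -/(joined a).
  by move=> ea eb eab; rewrite eab in ea *; rewrite (Prop_irrelevance ea eb).
have path a : {p | source p = base a /\ target p = a}.
  by apply: cid; exact: joined_sym.
exists (fun a => c (sval (path a))); apply/funext => s; rewrite coboundary1E.
have bE : base (target s) = base (source s) by apply/esym/base_eq; exists s.
case: (path (target s)) (path (source s)) => q /= [qb qt] [p /= [pb pt]].
rewrite bE in qb.
have [//|w [wb wt /(_ _ dc) cw]] := @concat p s.
have [|l [lb lt /(_ _ dc) cl]] := @concat w (reverse_path q).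
  by rewrite wt source_rev qt.
have := cl0 l; rewrite lb lt wb target_rev pb qb cl cw cocycle_rev //.
by move=> /(_ erefl) h; lia.
Qed.

End Concatenation.

(** * The fundamental cycle of a torus *)

(** In this part, [tor th] stands for the composite of a map from the cube
    [[0, 1]^m] with the affine map from the simplex to the cube whose [i]-th
    coordinate sends vertices to 0 or 1 as [th i] says. *)

Section PeriodicCube.
Context {R : realType} {Z : topologicalType} {m : nat}.
Variable tor : forall p, ('I_m -> 'I_p.+1 -> 'I_2) -> sing R p Z.

(** The simplex [0 <= x_{s^-1(m-1)} <= ... <= x_{s^-1(0)} <= 1] of the standard
    triangulation of the cube: its vertex [k] has the coordinates [i] with
    [s i < k] equal to 1. *)
Definition ladder (s : 'S_m) (i : 'I_m) (k : 'I_m.+1) : 'I_2 :=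
  if (s i < k)%N then ord_max else ord0.

(** Evaluation on the fundamental chain of the cube. *)
Definition torus_period (c : cochain R m Z) : int :=
  \sum_(s : 'S_m) (-1) ^+ s * c (tor (ladder s)).

Lemma torus_period_is_zmod_morphism : zmod_morphism torus_period.
Proof.
by move=> b c; rewrite /torus_period -sumrB; apply: eq_bigr => s _; rewrite -mulrBr.
Qed.

HB.instance Definition _ := GRing.isZmodMorphism.Build
  (cochain R m Z) int torus_period torus_period_is_zmod_morphism.

End PeriodicCube.

Section PeriodicCubeBoundary.
Context {R : realType} {Z : topologicalType} {M : nat}.
Notation m := M.+1.

Variable tor : forall p, ('I_m -> 'I_p.+1 -> 'I_2) -> sing R p Z.

Hypothesis tor_op : forall p r (th : 'I_m -> 'I_r.+1 -> 'I_2)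
  (f : 'I_p.+1 -> 'I_r.+1), sing_op f (tor th) = tor (fun i => th i \o f).

Hypothesis tor_periodic : forall p (th th' : 'I_m -> 'I_p.+1 -> 'I_2) i0,
  (forall i, i != i0 -> th i = th' i) ->
  th i0 = (fun=> ord0) -> th' i0 = (fun=> ord_max) -> tor th = tor th'.

(** The fundamental chain of the cube is a cycle when the cube is periodic.
    An inner face, which omits a vertex [k] with [0 < k < m], is shared by two
    simplices whose permutations differ by the transposition of [k - 1] and
    [k], hence have opposite signs. The face that omits the vertex 0 of the
    simplex of [s] lies in the side of the cube where a coordinate is 1; by
    periodicity it equals the face that omits the last vertex of the simplex
    of [s] followed by the cyclic permutation [rho], and the sign of [rho]
    makes the two cancel. *)
Lemma torus_period_coboundary (b : cochain R M Z) :
  torus_period tor (coboundary b) = 0.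
Proof.
pose S (k : 'I_M.+2) : int :=
  \sum_(s : 'S_m) (-1) ^+ s * b (tor (fun i => ladder s i \o lift k)).
have -> : torus_period tor (coboundary b) = \sum_(k < M.+2) (-1) ^+ k * S k.
  rewrite /torus_period /coboundary.
  under eq_bigr => s _ do rewrite big_distrr /=.
  rewrite exchange_big /=; apply: eq_bigr => k _; rewrite big_distrr /=.
  by apply: eq_bigr => s _; rewrite mulrCA tor_op.
have inner (k : 'I_M.+2) : (0 < k)%N -> (k < m)%N -> S k = 0.
  move=> k0 km.
  have k1m : (k.-1 < m)%N by lia.
  pose t : 'S_m := tperm (Ordinal k1m) (Ordinal km).
  suff : S k = - S k by lia.
  rewrite {1}/S (reindex_inj (mulIg t)) /S -sumrN; apply: eq_bigr => s _ /=.
  rewrite odd_permM odd_tperm.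
  have -> : Ordinal k1m != Ordinal km by apply/eqP => /(congr1 val) /=; lia.
  rewrite addbT signrN mulNr; congr (- (_ * b (tor _))).
  apply/funext => i; apply/funext => l; rewrite /ladder /= permM.
  by congr (if _ then _ else _); rewrite /t; case: tpermP => [->|->|_ _] //=;
    rewrite /bump; case: leqP; lia.
have outer : S ord0 = (-1) ^+ M * S ord_max.
  (* [rho] sends 0 to [M] and [j + 1] to [j]. *)
  pose rho : 'S_m := lift_perm ord0 ord_max 1.
  rewrite /S [in RHS](reindex_inj (mulIg rho)) big_distrr; apply: eq_bigr => s _ /=.
  rewrite odd_permM odd_lift_perm odd_perm1 addbF /= signr_addb signr_odd.
  rewrite mulrA mulrCA -expr2 sqrr_sign mulr1; congr (_ * b _); apply: esym.
  apply: (tor_periodic (i0 := s^-1%g ord0)) => [i i0||].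
  - have [j sj] : {j | s i = lift ord0 j}.
      case: (unliftP ord0 (s i)) => [j ->|si]; first by exists j.
      by move: i0; rewrite -si permK eqxx.
    apply/funext => l; rewrite /ladder /= permM sj lift_perm_lift perm1 /=.
    congr (if _ then _ else _); rewrite /bump.
    by case: (j) (l) => [j' ?] [l' ?] /=; case: leqP; case: leqP; lia.
  - apply/funext => l; rewrite /ladder /= permM permKV lift_perm_id /=.
    by rewrite ifF // /bump; case: (l) => [l' ?] /=; case: leqP; lia.
  - by apply/funext => l; rewrite /ladder /= permKV.
rewrite big_ord_recl big_ord_recr /= outer big1 => [|k _]; last first.
  by rewrite inner ?mulr0 // lift0 /= ltnS ltn_ord.
have -> : lift ord0 ord_max = ord_max :> 'I_M.+2 by apply/val_inj.
rewrite expr0 mul1r add0r /bump /= add1n exprS; ring.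
Qed.

Lemma torus_period_exact (c : cochain R m Z) :
  is_coboundary c -> torus_period tor c = 0.
Proof. by case=> b ->; exact: torus_period_coboundary. Qed.

End PeriodicCubeBoundary.

Section CupProd.
Context {R : realType} {X : topologicalType}.

Definition edge k (i : 'I_k) : 'I_2 -> 'I_k.+1 := fun j => inord (i + j).

(** An iterated Alexander-Whitney formula: a product of classes of degree one
    is represented by the cocycle that multiplies the values of the factors on
    the successive edges [k, k + 1] of a simplex. *)
Lemma cup_prodE k (a : 'I_k -> cocycle R 1 X) :
  {C : cocycle R k X | cup_prod (fun i => cls (a i)) = cls C &
    forall s, cocycle_val C s = \prod_i cocycle_val (a i) (sing_op (edge i) s)}.
Proof.
elim: k a => [|k IH] a.
  by exists (Cocycle (@cochain_one_subproof R X)) => // s; rewrite big_ord0.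
have [C CE Cs] := IH (fun i => a (lift ord0 i)).
exists (cocycle_cup (a ord0) C); first by rewrite /= CE cupE.
move=> s; rewrite big_ord_recl /= /cochain_cup Cs; congr (_ * _).
apply: eq_bigr => i _; rewrite sing_op_comp.
congr (cocycle_val _ (sing_op _ _)); apply/funext => j; apply/ord_inj.
have := ltn_ord i; have := ltn_ord j; rewrite /back /edge /= => ? ?.
by rewrite /bump !inordK; lia.
Qed.

End CupProd.

(** * Tori of configurations *)

(** A configuration of [n] points is assembled from [m] pairs of points, the
    [i]-th one moving in [A i] and carrying the labels [q i 0] and [q i 1],
    and from resting points for the remaining labels. *)

Section Spread.
Context {X : topologicalType} {m n : nat}.
Variables (q : 'I_m -> 'I_2 -> 'I_n) (A : 'I_m -> set X) (x : 'I_n -> X).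
Hypothesis q_inj : forall i, injective (q i).
Hypothesis q_disj : forall i j a b, q i a = q j b -> i = j.
Hypothesis A_disj : forall i j, i != j -> A i `&` A j = set0.
Hypothesis x_inj : forall k l, (forall i a, q i a != k) ->
  (forall i a, q i a != l) -> x k = x l -> k = l.
Hypothesis x_off : forall i l, (forall j a, q j a != l) -> ~ A i (x l).

Section Map.
Context {W : topologicalType}.
Variable s : forall i, continuousType W (Conf (A i) 2).

Definition spread_fun (w : W) (l : 'I_n) : X :=
  if [pick ia : 'I_m * 'I_2 | q ia.1 ia.2 == l] is Some ia
  then set_val (set_val (s ia.1 w) ia.2) else x l.

Lemma spread_fun_q w i a : spread_fun w (q i a) = set_val (set_val (s i w) a).
Proof.
rewrite /spread_fun; case: pickP => [[j b] /= /eqP jb|/(_ (i, a))]; last first.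
  by rewrite /= eqxx.
by have ji := q_disj jb; subst j; rewrite (q_inj jb).
Qed.

Lemma spread_fun_off w l : (forall i a, q i a != l) -> spread_fun w l = x l.
Proof.
by move=> ql; rewrite /spread_fun; case: pickP => // -[i a]; rewrite /= (negbTE (ql _ _)).
Qed.

Lemma q_cases l : (exists i a, l = q i a) \/ (forall i a, q i a != l).
Proof.
have [[i [a ->]]|ql] := pselect (exists i a, l = q i a); [left|right].
  by exists i, a.
by move=> i a; apply/eqP => qil; apply: ql; exists i, a.
Qed.

Lemma spread_subproof (w : W) :
  spread_fun w \in [set z : {ptws 'I_n -> X} | injective z].
Proof.
apply/mem_set => k l.
have [[i [a ->]]|qk] := q_cases k; have [[j [b ->]]|ql] := q_cases l.
- rewrite !spread_fun_q; have [ij|ij] := eqVneq i j.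
    by subst j => /set_val_inj /(set_valP (s i w)) ->.
  move=> E; have : (A i `&` A j) (set_val (set_val (s i w) a)).
    by split; [|rewrite E]; exact: set_valP.
  by rewrite A_disj.
- rewrite spread_fun_q spread_fun_off // => E.
  by case: (x_off (i := i) ql); rewrite -E; exact: set_valP.
- rewrite spread_fun_q spread_fun_off // => E.
  by case: (x_off (i := j) qk); rewrite E; exact: set_valP.
- by rewrite !spread_fun_off //; exact: x_inj.
Qed.

Definition spread (w : W) : Conf X n :=
  exist (fun y => y \in [set z : {ptws 'I_n -> X} | injective z]) _
    (spread_subproof w).

Lemma spread_continuous : continuous spread.
Proof.
apply: continuous_to_subtype; apply: continuous_to_prod => l.
have -> : (fun w => set_val (spread w) l) = (fun w => spread_fun w l) by [].
have [[i [a ->]]|ql] := q_cases l; last first.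
  have -> : (fun w => spread_fun w l) = cst (x l); last exact: cst_continuous.
  by apply/funext => w; rewrite spread_fun_off.
have -> : (fun w => spread_fun w (q i a)) =
    set_val \o ((fun g : {ptws 'I_2 -> A i} => g a) \o (set_val \o s i)).
  by apply/funext => w; rewrite spread_fun_q.
move=> w; apply: continuous_comp; last exact: continuous_set_val.
apply: continuous_comp; last exact: continuous_eval.
by apply: continuous_comp; [exact: cts_fun | exact: continuous_set_val].
Qed.

Lemma forget_spread i w :
  conf_forget (@q_inj i) (spread w) = conf_incl (A i) 2 (s i w).
Proof. by apply/val_inj/funext => a; rewrite -!set_valE; exact: spread_fun_q. Qed.

End Map.

Section Torus.
Context {R : realType}.
Variable l : forall i, sing R 1 (Conf (A i) 2).
Hypothesis l_closed : forall i, source (l i) = target (l i).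

(** The torus spanned by the loops [l i], restricted to the simplex with
    coordinate maps [th i]. *)
Definition torus p (th : 'I_m -> 'I_p.+1 -> 'I_2) : sing R p (Conf X n) :=
  mkcts (@spread_continuous _ (fun i => sing_op (th i) (l i))).

Lemma eq_torus p (th th' : 'I_m -> 'I_p.+1 -> 'I_2) :
  (forall i, sing_op (th i) (l i) = sing_op (th' i) (l i)) -> torus th = torus th'.
Proof.
move=> E; have {}E : (fun i => sing_op (th i) (l i)) = (fun i => sing_op (th' i) (l i)).
  exact: functional_extensionality_dep.
by rewrite /torus E.
Qed.

Lemma torus_op p r (th : 'I_m -> 'I_r.+1 -> 'I_2) (f : 'I_p.+1 -> 'I_r.+1) :
  sing_op f (torus th) = torus (fun i => th i \o f).
Proof.
rewrite {2}/torus; have -> : (fun i => sing_op (th i \o f) (l i)) =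
    (fun i => sing_op f (sing_op (th i) (l i))).
  by apply: functional_extensionality_dep => i; rewrite sing_op_comp.
by apply/continuousEP => y; apply/val_inj.
Qed.

(** The two sides of the cube transverse to a coordinate agree, because a loop
    has the same value at both ends. *)
Lemma torus_periodic p (th th' : 'I_m -> 'I_p.+1 -> 'I_2) i0 :
  (forall i, i != i0 -> th i = th' i) ->
  th i0 = (fun=> ord0) -> th' i0 = (fun=> ord_max) -> torus th = torus th'.
Proof.
move=> thE th0 th1; apply: eq_torus => i; have [->|/thE -> //] := eqVneq i i0.
have -> : th i0 = lift ord_max \o (fun=> ord0) :> ('I_p.+1 -> 'I_2).
  by rewrite th0; apply/funext => j; apply/val_inj.
have -> : th' i0 = lift ord0 \o (fun=> ord0) :> ('I_p.+1 -> 'I_2).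
  by rewrite th1; apply/funext => j; apply/val_inj.
by rewrite -!sing_op_comp -[sing_op (lift ord_max) _]/(source _) l_closed.
Qed.

(** Along the simplex of [s], the [i]-th coordinate runs from 0 to 1 on the
    edge [s i], and it is constant on all other edges. *)
Lemma edge_ladder (s : 'S_m) i :
  ladder s i \o edge (s i) = id /\
  forall k, k != s i -> exists a, ladder s i \o edge k = (fun=> a).
Proof.
split=> [|k ki].
  apply/funext => j; rewrite /ladder /edge /=; apply/ord_inj.
  have := ltn_ord j; have := ltn_ord (s i) => ? ?.
  by rewrite inordK; [case: ltnP => /=; lia | lia].
exists (if (s i < k)%N then ord_max else ord0).
apply/funext => j; rewrite /ladder /edge /=; congr (if _ then _ else _).
have := ltn_ord j; have := ltn_ord k => ? ?.
have : s i <> k :> nat by move=> /ord_inj E; rewrite E eqxx in ki.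
by rewrite inordK; lia.
Qed.

(** When the [i]-th factor depends only on the [i]-th pair of points, its value
    on the [i]-th edge of the simplex of [s] vanishes unless that edge moves
    the [i]-th coordinate; hence only the simplex of the identity contributes,
    and it contributes the product of the values on the loops. *)
Lemma torus_period_prod (c : 'I_m -> cochain R 1 (Conf X 2)) :
  (forall i, coboundary (c i) = 0) ->
  \sum_(s : 'S_m) (-1) ^+ s * \prod_i cochain_pull (conf_forget (@q_inj i)) (c i)
      (sing_op (edge i) (torus (ladder s))) =
  \prod_i c i ((conf_incl (A i) 2 : _ -> _) \o l i) :> int.
Proof.
move=> dc.
have pullE i s : cochain_pull (conf_forget (@q_inj i)) (c i)
    (sing_op (edge i) (torus (ladder s))) =
    c i ((conf_incl (A i) 2 : _ -> _) \o sing_op (ladder s i \o edge i) (l i)).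
  rewrite torus_op; congr (c i _); apply/continuousEP => y.
  exact: (@forget_spread _ (fun j => sing_op (ladder s j \o edge i) (l j))).
rewrite (bigD1 1%g) //= odd_perm1 expr0 mul1r [X in _ + X]big1 ?addr0 => [|s s1].
  apply: eq_bigr => i _; rewrite pullE; congr (c i (_ \o _)).
  have [+ _] := edge_ladder 1%g i; rewrite perm1 => ->.
  by apply/continuousEP => y; rewrite sing_op_id.
have [i si] : exists i, i != s i.
  apply/existsP; apply: contraR s1; rewrite negb_exists => /forallP s1.
  by apply/eqP/permP => i; rewrite perm1; have := s1 i; rewrite negbK => /eqP <-.
have [_ /(_ i si) [a la]] := edge_ladder s i.
rewrite (bigD1 i) //= pullE la.
suff -> : c i ((conf_incl (A i) 2 : _ -> _) \o sing_op (fun=> a) (l i)) = 0.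
  by rewrite mul0r mulr0.
rewrite -[RHS](cocycle_const ((conf_incl (A i) 2 : _ -> _) \o
  sing_op (fun=> a) (l i) : sing R 0 (Conf X 2)) (dc i)).
congr (c i _); apply/continuousEP => y /=; congr (conf_map _ (l i _)).
by rewrite push_comp.
Qed.

End Torus.

End Spread.

(** * Independence of the cup products *)

Section Detection.
Context {R : realType} {X : topologicalType}.

Lemma loop_of_neq0 (Y : topologicalType) (f : continuousType Y X)
    (a : cohomology R 1 X) : pullback f a <> 0 ->
  exists l : sing R 1 Y, source l = target l /\
    cocycle_val (repr a) ((f : Y -> X) \o l) <> 0.
Proof.
move=> a0; apply: contrapT => nol; apply: a0.
apply/cls_eq0/loops_detect => [|l ll]; first exact: cocycleP.
by apply: contrapT => al; apply: nol; exists l.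
Qed.

Lemma loop_of_eq0 (Y : topologicalType) (f : continuousType Y X)
    (a : cohomology R 1 X) (l : sing R 1 Y) : pullback f a = 0 ->
  source l = target l -> cocycle_val (repr a) ((f : Y -> X) \o l) = 0.
Proof.
move=> /cls_eq0 [b ab] ll; have := congr1 (fun g => g l) ab.
by rewrite coboundary1E ll subrr.
Qed.

End Detection.

(** The duality at the heart of the matter. For a permutation [t], let the
    [i]-th pair of points run through a loop in [A (t i)] that detects
    [alpha (t i)]. On the resulting torus, the product indexed by [s] is the
    product over [i] of the values of [alpha (s i)] on the [i]-th loop, which
    vanishes unless [s = t] and is nonzero when [s = t]. So the tori form a
    dual family of the products, up to nonzero factors. *)
Theorem cup_products_independent (R : realType) (X : topologicalType) m n
    (q : 'I_m.+1 -> 'I_2 -> 'I_n) (q_inj : forall i, injective (q i))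
    (q_disj : forall i j a b, q i a = q j b -> i = j)
    (A : 'I_m.+1 -> set X) (A_disj : forall i j, i != j -> A i `&` A j = set0)
    (x : 'I_n -> X)
    (x_inj : forall k l, (forall i a, q i a != k) ->
       (forall i a, q i a != l) -> x k = x l -> k = l)
    (x_off : forall i l, (forall j a, q j a != l) -> ~ A i (x l))
    (alpha : 'I_m.+1 -> cohomology R 1 (Conf X 2))
    (alpha_ne0 : forall j, pullback (conf_incl (A j) 2) (alpha j) <> 0)
    (alpha_eq0 : forall i j, i != j ->
       pullback (conf_incl (A i) 2) (alpha j) = 0) :
  Z_independent (fun s : 'S_m.+1 =>
    cup_prod (fun i => pullback (conf_forget (q_inj i)) (alpha (s i)))).
Proof.
pose a j := cocycle_val (repr (alpha j)).
pose l j := sval (cid (loop_of_neq0 (@alpha_ne0 j))).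
have lP j : source (l j) = target (l j) /\
    a j ((conf_incl (A j) 2 : _ -> _) \o l j) <> 0.
  exact: (svalP (cid (loop_of_neq0 (@alpha_ne0 j)))).
have al0 i j : i != j -> a j ((conf_incl (A i) 2 : _ -> _) \o l i) = 0.
  by move=> ij; apply: loop_of_eq0; [exact: alpha_eq0 | exact: (lP i).1].
have C (s : 'S_m.+1) := cup_prodE
  (fun i => cocycle_pull (conf_forget (q_inj i)) (repr (alpha (s i)))).
move=> c; pose D : cocycle R m.+1 (Conf X n) := \sum_(s : 'S_m.+1) s2val (C s) *~ c s.
have -> : \sum_(s : 'S_m.+1) cup_prod
    (fun i => pullback (conf_forget (q_inj i)) (alpha (s i))) *~ c s = cls D.
  rewrite /D raddf_sum; apply: eq_bigr => s _; rewrite raddfMz.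
  by congr (_ *~ _); case: (C s).
move=> /cls_eq0 D0 t.
have At_disj i j : i != j -> A (t i) `&` A (t j) = set0.
  by move=> ij; apply: A_disj; rewrite (inj_eq perm_inj).
have lt_closed i : source (l (t i)) = target (l (t i)) by exact: (lP _).1.
pose T := torus q_inj q_disj At_disj x_inj (fun i => @x_off (t i)) (fun i => l (t i)).
have TE s : torus_period T (s2val (C s)) =
    \prod_i a (s i) ((conf_incl (A (t i)) 2 : _ -> _) \o l (t i)).
  rewrite -(torus_period_prod q_inj q_disj At_disj x_inj (fun i => @x_off (t i))
    (fun i => l (t i)) (c := fun i => a (s i))); last first.
    by move=> i; exact: cocycleP.
  by apply: eq_bigr => p _; congr (_ * _); case: (C s).
have : torus_period T D = 0.
  apply: torus_period_exact D0; first exact: torus_op.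
  exact: torus_periodic.
rewrite /D raddf_sum raddf_sum (bigD1 t) //= [X in _ + X]big1 ?addr0; last first.
  move=> s st; rewrite !raddfMz /= TE.
  have [i sti] : exists i, t i != s i.
    apply/existsP; apply: contraR st; rewrite negb_exists => /forallP st.
    by apply/eqP/permP => i; have := st i; rewrite negbK => /eqP.
  by rewrite (bigD1 i) //= al0 // mul0r mul0rz.
rewrite !raddfMz /= TE => /eqP; rewrite -mulrzr intz mulf_eq0 => /orP[|/eqP //].
by rewrite prodf_seq_eq0 => /hasP [i _] /= /eqP; have [_] := lP (t i).
Qed.

(** * Lifting real functions modulo one *)

Section Compact.
Context {R : realType}.

Lemma simplex_compact (V : finType) : compact (@simplex R V).
Proof.
apply: (@subclosed_compact _ _ [set f : {ptws V -> R} | forall v, `[0, 1]%classic (f v)]).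
- have -> : @simplex R V = \bigcap_(v in [set: V]) [set f : {ptws V -> R} | 0 <= f v] `&`
      [set f : {ptws V -> R} | \sum_v f v = 1].
    apply/seteqP; split=> f.
      by move=> [f0 f1]; split => // v _; exact: f0.
    by move=> [f0 f1]; split => // v; exact: f0.
  apply: closedI.
    apply: closed_bigI => v _.
    apply: (@preimage_closed _ _ (fun f : {ptws V -> R} => f v) [set x | 0 <= x]).
      by move=> f _; exact: continuous_eval.
    exact: closed_ge.
  apply: (@preimage_closed _ _ (fun f : {ptws V -> R} => \sum_v f v) [set x | x = 1]).
    move=> f _; apply: (@continuous_sum R _ _ _ _ (fun v (f : {ptws V -> R}) => f v)) => v.
    exact: continuous_eval.
  exact: closed_eq.
- by apply: (@tychonoff _ (fun=> R) (fun=> `[0, 1]%classic)) => v; exact: segment_compact.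
- move=> f fS v; rewrite /= in_itv /=.
  have := @Delta_bounds R V (exist _ f (mem_set fS)) v.
  by rewrite set_valE.
Qed.

Lemma Delta_compact (V : finType) : compact [set: Delta R V].
Proof.
move=> F PF _.
have [p [Sp clp]] := @simplex_compact V (set_val @ F) _
  (filterS (fun x _ => set_valP x) filterT).
exists (exist _ p (mem_set Sp)); split=> // B C FB [_ [[U oU <-]] /= Up UC].
have : (set_val @ F) (set_val @` B).
  by apply: (@filterS _ F _ B) FB => y By; exists y.
have /clp /[apply] : nbhs p U by apply: open_nbhs_nbhs; split=> //; move: Up; rewrite set_valE.
by move=> [_ [[y By <-] Uy]]; exists y; split=> //; exact: UC.
Qed.

End Compact.

Section Mod1.
Context {R : realType}.

(** Continuity of [g] as a map to the circle [R/Z]. *)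
Definition continuous_mod1 (X : topologicalType) (g : X -> R) :=
  forall x (e : R), 0 < e ->
  \forall y \near x, exists k : int, `|g y - g x - k%:~R| < e.

Lemma continuous_mod1_comp (X Y : topologicalType) (f : X -> Y) (g : Y -> R) :
  continuous f -> continuous_mod1 g -> continuous_mod1 (g \o f).
Proof.
move=> cf cg x e e0; exact: (cf x _ (cg (f x) e e0)).
Qed.

Lemma continuous_mod1_sub (X : topologicalType) (f g : X -> R) :
  continuous_mod1 f -> continuous_mod1 g -> continuous_mod1 (fun x => f x - g x).
Proof.
move=> cf cg x e e0; have e20 : 0 < e / 2 by rewrite divr_gt0.
apply: filterS2 (cf x _ e20) (cg x _ e20) => y [k fk] [l gl]; exists (k - l).
rewrite intrB (_ : _ - _ = f y - f x - k%:~R - (g y - g x - l%:~R)); last by ring.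
by apply: le_lt_trans (ler_normB _ _) _; rewrite [ltRHS]splitr ltrD.
Qed.

(** A function that stays within 1/4 of the integers is continuous once its
    nearest integer [K x] is subtracted: nearby, [K y - K x] differs by less
    than 1 from the integer that makes [D] continuous modulo 1. *)
Lemma continuous_unwrap (X : topologicalType) (D : X -> R) :
  continuous_mod1 D ->
  (forall x, exists k : int, `|D x - k%:~R| < 4^-1) ->
  exists K : X -> int, continuous (fun x => D x - (K x)%:~R).
Proof.
move=> cD /choice [K KP]; exists K => x.
apply/cvgrPdist_lt => e e0; have m0 : 0 < Num.min e 4^-1.
  by rewrite lt_min e0 invr_gt0 ltr0n.
apply: filterS (cD x _ m0) => y [k]; rewrite lt_min => /andP[ke k4].
suff kE : k = K y - K x.
  rewrite distrC; rewrite (_ : _ - _ = D y - D x - k%:~R) //.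
  by rewrite kE intrB; ring.
have : `|(K y - K x - k)%:~R| < 1 :> R.
  rewrite !intrB (_ : _ - _ = (D y - D x - k%:~R) - (D y - (K y)%:~R) +
    (D x - (K x)%:~R)); last by ring.
  apply: le_lt_trans (ler_normD _ _) _.
  apply: (@lt_le_trans _ _ (4^-1 + 4^-1 + 4^-1)); last by lra.
  apply: ltrD; last exact: KP.
  by apply: le_lt_trans (ler_normB _ _) _; apply: ltrD; [exact: k4 | exact: KP].
rewrite -intr_norm -[1]/(1%:~R) ltr_int => h; lia.
Qed.

End Mod1.

Section Lifting.
Context {R : realType} {V : finType} (o : V).
Notation D := (Delta R V).

Lemma cone_subproof (p : R * D) :
  (fun w => (1 - clamp p.1) * (w == o)%:R + clamp p.1 * set_val p.2 w) \in
    @simplex R V.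
Proof.
have /andP[t0 t1] := clamp_bounds p.1; have [x0 x1] := set_valP p.2.
apply/mem_set; split=> [w|].
  by rewrite addr_ge0 // mulr_ge0 ?x0 ?ler0n ?subr_ge0.
rewrite big_split -!big_distrr /= x1 mulr1 (bigD1 o) //= eqxx big1 => [|w /negbTE -> //].
by rewrite addr0 mulr1 subrK.
Qed.

(** The contraction of the simplex to its vertex [o] along segments. *)
Definition cone (p : R * D) : D :=
  exist (fun y => y \in @simplex R V) _ (cone_subproof p).

Lemma cone_continuous : continuous cone.
Proof.
apply: continuous_to_subtype; apply: continuous_to_prod => w.
have -> : (fun p => set_val (cone p) w) =
  fun p => (1 - clamp p.1) * (w == o)%:R + clamp p.1 * set_val p.2 w by [].
have c1 : continuous (fun p : R * D => clamp p.1).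
  by move=> p; apply: continuous_comp; [exact: cvg_fst | exact: clamp_continuous].
have c2 : continuous (fun p : R * D => set_val p.2 w).
  move=> p; apply: (@continuous_comp _ _ _ snd (fun x : D => set_val x w)).
    exact: cvg_snd.
  exact: bary_continuous.
apply: continuous_add; apply: continuous_mul => //; last exact: cst_continuous.
by apply: continuous_sub => //; exact: cst_continuous.
Qed.

Lemma cone_slice t : continuous (fun x : D => cone (t, x)).
Proof.
move=> x; apply: (@continuous_comp _ _ _ (pair t) cone); last exact: cone_continuous.
by apply: continuous_pair; [exact: cst_continuous | by move=> ?; exact: cvg_id].
Qed.

Lemma cone_path (x : D) : continuous (fun t => cone (t, x)).
Proof.
move=> t; apply: (@continuous_comp _ _ _ (fun t => (t, x)) cone).
  by apply: continuous_pair; [by move=> ?; exact: cvg_id | exact: cst_continuous].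
exact: cone_continuous.
Qed.

Lemma cone1 x : cone (1, x) = x.
Proof.
apply/val_inj/funext => w /=; rewrite clamp_id ?ler01 ?lexx //.
by rewrite subrr mul0r add0r mul1r set_valE.
Qed.

Lemma cone0 x y : cone (0, x) = cone (0, y).
Proof.
apply/val_inj/funext => w /=; rewrite clamp_id ?ler01 ?lexx //.
by rewrite !mul0r.
Qed.

(** Uniform continuity of [G] on the cone, obtained from the compactness of
    [[0, 1]] times the simplex rather than from a metric on the simplex. *)
Lemma cone_steps (G : D -> R) : continuous_mod1 G ->
  exists N : nat, forall x t t', 0 <= t <= 1 -> `|t - t'| <= N.+1%:R^-1 ->
  exists k : int, `|G (cone (t', x)) - G (cone (t, x)) - k%:~R| < 4^-1.
Proof.
move=> cG; pose H := G \o cone.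
have cH : continuous_mod1 H by exact: continuous_mod1_comp cone_continuous cG.
pose P (N : nat) (p : R * D) := forall t', `|p.1 - t'| <= N.+1%:R^-1 ->
  exists k : int, `|H (t', p.2) - H p - k%:~R| < 4^-1.
have /compact_near_coveringP /(_ nat \oo P) :
    compact (`[0, 1]%classic `*` [set: D] : set (R * D)).
  by apply: compact_setX; [exact: segment_compact | exact: Delta_compact].
case=> [[t0 x0] _|N _ /(_ N (leqnn N)) NP]; last first.
  by exists N => x t t' t01 tt'; apply: (NP (t, x)) => //=; rewrite ?in_itv.
have e0 : 0 < 8^-1 :> R by rewrite invr_gt0 ltr0n.
have [[B C] /= [Bt Cx] BC] := cH (t0, x0) _ e0.
move: Bt => /nbhs_ballP [d /= d0 dB].
have d20 : 0 < d / 2 by rewrite divr_gt0.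
exists (ball t0 (d / 2) `*` C, [set N | N.+1%:R^-1 < d / 2]).
  split=> /=.
    by exists (ball t0 (d / 2), C) => //=; split=> //; exact: nbhsx_ballx.
  by move: (d / 2) d20 => _ /posnumP[r]; exact: near_infty_natSinv_lt.
move=> [[t x] N] /= [[tb Cx'] Nd] t' tt' /=.
have tB : B t.
  by apply: dB; apply: le_ball tb; lra.
have tB' : B t'.
  apply: dB; rewrite /ball /=; move: tb; rewrite /ball /= => tb.
  rewrite (_ : t0 - t' = (t0 - t) + (t - t')); last by ring.
  apply: le_lt_trans (ler_normD _ _) _; rewrite [ltRHS]splitr ltrD //.
  exact: le_lt_trans tt' Nd.
have [k hk] := BC (t', x) (conj tB' Cx'); have [j hj] := BC (t, x) (conj tB Cx').
exists (k - j); rewrite intrB (_ : _ - _ = (H (t', x) - H (t0, x0) - k%:~R) -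
  (H (t, x) - H (t0, x0) - j%:~R)); last by ring.
apply: le_lt_trans (ler_normB _ _) _.
by apply: (@lt_le_trans _ _ (8^-1 + 8^-1)); [exact: ltrD | lra].
Qed.

(** The homotopy lifting argument. In steps of length [1 / (N + 1)] along the
    segments from the vertex [o], the function changes by less than 1/4 modulo
    1, so each increment can be lifted continuously; the sum of the increments
    lifts [G], up to its value at [o]. *)
Lemma lift_exists (G : D -> R) : continuous_mod1 G ->
  exists K : D -> int, continuous (fun x => G x + (K x)%:~R).
Proof.
move=> cG; have [N NP] := cone_steps cG.
pose t (k : nat) : R := k%:R / N.+1%:R.
have step k : (k <= N)%N -> exists K : D -> int,
    continuous (fun x => G (cone (t k.+1, x)) - G (cone (t k, x)) - (K x)%:~R).
  move=> kN; apply: continuous_unwrap.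
    by apply: continuous_mod1_sub; apply: (continuous_mod1_comp _ cG); exact: cone_slice.
  move=> x; apply: NP.
    rewrite /t divr_ge0 ?ler0n //= ler_pdivrMr ?ltr0n // mul1r ler_nat.
    exact: leqW.
  by rewrite /t -mulrBl -natr1 opprD addrA subrr add0r mulN1r normrN gtr0_norm ?invr_gt0 ?ltr0n.
have telescope n : (n <= N.+1)%N -> exists K : D -> int,
    continuous (fun x => G (cone (t n, x)) - G (cone (t 0%N, x)) + (K x)%:~R).
  elim: n => [|n IH] nN.
    exists (fun=> 0); rewrite (_ : (fun x => _) = cst 0); first exact: cst_continuous.
    by apply/funext => x; rewrite subrr addr0.
  have [K cK] := IH (ltnW nN); have [L cL] := step n nN.
  exists (fun x => K x - L x).
  rewrite (_ : (fun x => _) = (fun x =>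
    (G (cone (t n, x)) - G (cone (t 0%N, x)) + (K x)%:~R) +
    (G (cone (t n.+1, x)) - G (cone (t n, x)) - (L x)%:~R))).
    exact: continuous_add.
  by apply/funext => x; rewrite intrB; ring.
have [K cK] := telescope _ (leqnn _); exists K.
pose c := G (cone (0, push (fun=> o) (seg 0))).
rewrite (_ : (fun x => _) = (fun x =>
    (G (cone (t N.+1, x)) - G (cone (t 0%N, x)) + (K x)%:~R) + c)).
  by apply: continuous_add cK _; exact: cst_continuous.
apply/funext => x; rewrite /t divff ?pnatr_eq0 // cone1 mul0r /c.
by rewrite (cone0 x (push (fun=> o) (seg 0))); ring.
Qed.

(** By the intermediate value theorem along the segments from [o], a continuous
    function with integer values cannot jump. *)
Lemma lift_unique (K : D -> int) : continuous (fun x => (K x)%:~R : R) ->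
  forall x y, K x = K y.
Proof.
move=> cK; suff h x : K x = K (cone (0, x)).
  by move=> x y; rewrite h (cone0 x y) -h.
pose f t : R := (K (cone (t, x)))%:~R.
have cf : continuous f.
  move=> t; apply: (@continuous_comp _ _ _ (fun t => cone (t, x)) (fun x : D => (K x)%:~R : R)).
    exact: cone_path.
  exact: cK.
have f1 : f 1 = (K x)%:~R by rewrite /f cone1.
apply/eqP/negPn/negP => Kne.
pose v : R := (Num.min (K x) (K (cone (0, x))))%:~R + 2^-1.
have [|c _] := @IVT R f 0 1 v ler01 (continuous_subspaceT cf).
  rewrite f1 /f /v; move: (K x) (K (cone (0, x))) Kne => a b ab.
  rewrite ge_min le_max.
  have [abl|bal] := leP a b.
    have : (a + 1)%:~R <= b%:~R :> R by rewrite ler_int; lia.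
    by rewrite intrD => ?; apply/andP; split; apply/orP; [right|left]; lra.
  have : (b + 1)%:~R <= a%:~R :> R by rewrite ler_int; lia.
  by rewrite intrD => ?; apply/andP; split; apply/orP; [left|right]; lra.
rewrite /f /v; set a := K _; set b := Num.min _ _ => E.
have : (2 * (a - b))%:~R = 1%:~R :> R by rewrite intrM intrB E; field.
move=> /intr_inj h; lia.
Qed.

End Lifting.

(** * The winding class *)

Section Winding.
Context {R : realType} {X : topologicalType} (g : X -> R).
Hypothesis cg : continuous_mod1 g.

(** A lift of [g] along [s] to the real line is encoded by the integers to be
    added to [g]. *)
Definition is_lift n (s : sing R n X) (K : Delta R 'I_n.+1 -> int) :=
  continuous (fun x => g (s x) + (K x)%:~R).

Lemma has_lift n (s : sing R n X) : exists K, is_lift s K.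
Proof.
by apply: (lift_exists ord0); apply: continuous_mod1_comp cg; exact: cts_fun.
Qed.

(** The total variation of a lift of [g] along the path is
    [g (s 1) - g (s 0) + winding s]; subtracting the coboundary of the real
    cochain [g] makes the class integral. *)
Definition winding : cochain R 1 X :=
  fun s => let K := sval (cid (has_lift s)) in K (seg 1) - K (seg 0).

Lemma windingE s K : is_lift s K -> winding s = K (seg 1) - K (seg 0).
Proof.
move=> sK; rewrite /winding; case: cid => L /= sL.
have cKL : continuous (fun x => (K x - L x)%:~R : R).
  rewrite (_ : (fun _ => _) =
    fun x => (g (s x) + (K x)%:~R) - (g (s x) + (L x)%:~R)).
    exact: continuous_sub.
  by apply/funext => x; rewrite intrB; ring.
by have := lift_unique ord0 cKL (seg 1) (seg 0) => h; lia.
Qed.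

(** A lift on a triangle restricts to lifts on its three sides, so the alternating
    sum of the three windings telescopes. *)
Lemma winding_cocycle : coboundary winding = 0.
Proof.
apply/funext => s; have [K sK] := has_lift s.
have z : Delta R 'I_1 := push (fun=> ord0) (seg 0).
pose W j := K (push (fun=> inord j) z).
have faceE k : (k < 3)%N -> winding (sing_op (skip k) s) = W (bump k 1) - W (bump k 0).
  move=> k3; rewrite (@windingE _ (K \o push (skip k))); last first.
    move=> x; apply: (@continuous_comp _ _ _ (push (skip k))
      (fun x => g (s x) + (K x)%:~R)); last exact: sK.
    exact: push_continuous.
  rewrite /= (seg1 z) (seg0 z) !push_comp; rewrite /W; congr (K (push _ z) - K (push _ z)).
    by apply/funext => i; apply/ord_inj; rewrite ord1 /= !inordK //; rewrite /bump; lia.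
  by apply/funext => i; apply/ord_inj; rewrite ord1 /= !inordK //; rewrite /bump; lia.
by rewrite coboundary2E !faceE //= -[RHS]/(0 : int); ring.
Qed.

Definition winding_class : cohomology R 1 X :=
  cls (Cocycle (introT eqP winding_cocycle)).

Lemma winding_continuous (s : sing R 1 X) :
  continuous (fun x => g (s x)) -> winding s = 0.
Proof.
move=> cgs; rewrite (@windingE _ (fun=> 0)) ?subrr // /is_lift.
by rewrite (_ : (fun _ => _) = (fun x => g (s x))) //; apply/funext => x; rewrite addr0.
Qed.

Lemma winding_integral (s : sing R 1 X) (J : Delta R 'I_2 -> int) :
  (forall x, g (s x) = (J x)%:~R) -> winding s = J (seg 0) - J (seg 1).
Proof.
move=> gJ; rewrite (@windingE _ (fun x => - J x)) ?opprK 1?addrC // /is_lift.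
rewrite (_ : (fun _ => _) = cst 0); first exact: cst_continuous.
by apply/funext => x; rewrite gJ mulrNz subrr.
Qed.

Lemma winding_class_eq0 (Y : topologicalType) (f : continuousType Y X) :
  (forall y, exists k : int, g (f y) = k%:~R) -> pullback f winding_class = 0.
Proof.
move=> /choice [J gJ]; rewrite pullbackE; apply/cls_eq0.
exists (fun a : sing R 0 Y => - J (a (push (fun=> ord0) (seg 0)))).
apply/funext => s; rewrite coboundary1E /= /cochain_pull.
rewrite (@winding_integral _ (J \o s)) //=.
by rewrite /source /target /= -seg0 -seg1 opprK addrC.
Qed.

End Winding.

(** With [0 / 0 = 0], the ratio is 0 where [p] vanishes and 1 where only [q]
    vanishes; modulo 1 these values agree, so the common zeros of [p] and [q]
    are harmless as long as one of the two functions vanishes around them. *)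
Lemma continuous_mod1_ratio (R : realType) (X : topologicalType) (p q : X -> R) :
  continuous p -> continuous q -> (forall x, 0 <= p x) -> (forall x, 0 <= q x) ->
  (forall x, p x = 0 -> q x = 0 ->
    (\forall y \near x, p y = 0) \/ (\forall y \near x, q y = 0)) ->
  continuous_mod1 (fun x => p x / (p x + q x)).
Proof.
move=> cp cq p0 q0 pq x e e0; have [pq0|pqN0] := eqVneq (p x + q x) 0.
  have /andP[/eqP px /eqP qx] : (p x == 0) && (q x == 0) by rewrite -paddr_eq0 // pq0.
  have [H|H] := pq x px qx; apply: filterS H => y.
    by exists 0; rewrite H px !mul0r !subrr normr0.
  move=> qy; rewrite qy addr0 px mul0r subr0; have [->|py] := eqVneq (p y) 0.
    by exists 0; rewrite mul0r subrr normr0.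
  by exists 1; rewrite divff // subrr normr0.
have c : (fun y => p y / (p y + q y)) y @[y --> x] --> p x / (p x + q x).
  by apply: cvgM; [exact: cp | apply: cvgV => //; apply: cvgD; [exact: cp | exact: cq]].
move/cvgrPdist_lt: c => /(_ e e0); apply: filterS => y ye.
by exists 0; rewrite subr0 distrC.
Qed.

(** * Branches of a tree at a vertex *)

Section Star.
Context {R : realType} {V : finType} {e : rel V}.
Hypothesis e_tree : is_tree e.
Variable v : V.
Notation G := (realization R e).

Lemma tree_sym : symmetric e. Proof. by case: e_tree => -[]. Qed.
Lemma tree_irr : irreflexive e. Proof. by case: e_tree => -[]. Qed.

Definition away : rel V := fun a b => [&& e a b, a != v & b != v].
(** For a neighbour [b] of [v], the component of [b] once [v] is removed. *)
Definition branch (b : V) : pred V := connect away b.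

Lemma neighbour_neq b : e v b -> b != v.
Proof. by move=> evb; apply: contraTneq evb => ->; rewrite tree_irr. Qed.

Lemma branch_v b : e v b -> branch b v = false.
Proof.
move=> evb; apply/negP => /connectP [p + vp].
elim/last_ind: p vp => [vb|p w _]; last rewrite last_rcons => <-.
  by have := neighbour_neq evb; rewrite vb eqxx.
by rewrite rcons_path /away => /andP[_ /and3P[_ _]]; rewrite eqxx.
Qed.

Lemma branch_edge b a w : e v b -> a != v -> branch b w -> e a w -> branch b a.
Proof.
move=> evb av bw eaw; apply: connect_trans (bw) _; apply: connect1.
rewrite /away tree_sym eaw av andbT /=; apply: contraTneq bw => ->.
by rewrite (branch_v evb).
Qed.

(** A path between distinct neighbours of [v] that avoids [v] would close up
    through [v] to a circuit of the tree. *)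
Lemma branch_eq b c : e v b -> e v c -> branch b c = (b == c).
Proof.
move=> evb evc; apply/idP/eqP => [/connectP [p pp cp]|->]; last exact: connect0.
move: cp; case: (shortenP pp) => p' pp' up' _ cp'.
apply: contraTeq isT => bc.
have [_ _ /(_ [:: v, b & p'])] := e_tree.
suff C : ucycle e [:: v, b & p'].
  move=> /(_ C); case: p' cp' {pp' up' C} => [/= cb|x p' _] //=.
  by rewrite cb eqxx in bc.
rewrite /ucycle /= rcons_path -cp' evb tree_sym evc andbT /=.
rewrite (sub_path _ pp') => [|x y /and3P[] //].
move: up' => /= ->; rewrite inE eq_sym (negbTE (neighbour_neq evb)) andbT /=.
elim: (p') (b) pp' => //= x s IH y /andP[/and3P[_ _ xv] ps].
by rewrite inE eq_sym (negbTE xv) /=; exact: IH ps.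
Qed.

Lemma away_sym : connect_sym away.
Proof.
apply: sym_connect_sym => a b; rewrite /away tree_sym.
by case: (e b a); rewrite //= andbC.
Qed.

Lemma branch_disjoint b c w : e v b -> e v c -> branch b w -> branch c w -> b = c.
Proof.
move=> evb evc bw cw; apply/eqP; rewrite -branch_eq //.
by apply: connect_trans bw _; rewrite away_sym.
Qed.

Lemma realization_coord_ge0 (x : G) w : 0 <= set_val x w.
Proof. by have [[x0 _] _] := set_valP x; exact: x0. Qed.

Lemma realization_coord_sum (x : G) : \sum_w set_val x w = 1.
Proof. by have [[_ x1] _] := set_valP x. Qed.

Lemma realization_coord_continuous w : continuous (fun x : G => set_val x w).
Proof.
move=> x; apply: (@continuous_comp _ _ _ set_val (fun g : {ptws V -> R} => g w)).
  exact: continuous_set_val.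
exact: continuous_eval.
Qed.

(** A substitute for the distance to [v] along the branch of [b]: it is
    continuous and vanishes exactly outside the open branch. *)
Definition height (b : V) (x : G) : R := \sum_(w | branch b w) set_val x w.

Lemma height_ge0 b x : 0 <= height b x.
Proof. by apply: sumr_ge0 => w _; exact: realization_coord_ge0. Qed.

Lemma height_continuous b : continuous (height b).
Proof.
by apply: continuous_sum => w; exact: realization_coord_continuous.
Qed.

(** The points with a nonzero coordinate at [a] form the open star of [a]; for
    [a] other than [v], it only meets the branch of [b] if [a] belongs to it. *)
Lemma height_eq0 b a (x : G) : e v b -> a != v -> ~~ branch b a ->
  set_val x a != 0 -> height b x = 0.
Proof.
move=> evb av ba xa; apply: big1 => w bw; apply/eqP; apply: contraNT (ba) => xw.
have wa : w != a by apply: contraNneq ba => <-.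
apply: (branch_edge evb av bw).
have [_ [c [d [cd supp]]]] := set_valP x.
case/orP: (supp _ xa) => /eqP ac; case/orP: (supp _ xw) => /eqP wc; subst.
- by rewrite eqxx in wa.
- by case: cd => // ac; rewrite ac eqxx in wa.
- by rewrite tree_sym; case: cd => // ac; rewrite ac eqxx in wa.
- by rewrite eqxx in wa.
Qed.

Lemma neq_vertex (x : G) : x <> vertex R e v -> exists2 a, a != v & set_val x a != 0.
Proof.
move=> xv; apply: contrapT => noa; apply: xv.
have x0 a : a != v -> set_val x a = 0.
  by move=> av; apply/eqP; apply: contrapT => /negP xa; apply: noa; exists a.
apply/set_val_inj/funext => a; rewrite -[RHS]/((a == v)%:R).
have [->|/x0 //] := eqVneq a v.
by rewrite -[RHS](realization_coord_sum x) (bigD1 v) //= big1 ?addr0 // => w /x0.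
Qed.

(** The only boundary point of the open branch is [v]. *)
Lemma height_near0 b (x : G) : e v b -> x <> vertex R e v -> height b x = 0 ->
  \forall y \near x, height b y = 0.
Proof.
move=> evb /neq_vertex [a av xa] /eqP.
rewrite psumr_eq0 => [/allP h|w _]; last exact: realization_coord_ge0.
have ba : ~~ branch b a.
  by apply: contra xa => ba; have := h a (mem_index_enum _); rewrite ba.
have xa0 : 0 < set_val x a by rewrite lt0r xa realization_coord_ge0.
have H := cvgr_gt _ (@realization_coord_continuous a x) 0 xa0.
apply: filterS (H _) => y ya; apply: height_eq0 evb av ba _.
by rewrite gt_eqF.
Qed.

Section Circle.
Variables (b1 b2 : V).
Hypotheses (e1 : e v b1) (e2 : e v b2) (b12 : b1 != b2).

Definition height1 (z : Conf G 2) : R := height b1 ((set_val z : 'I_2 -> G) ord0).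
Definition height2 (z : Conf G 2) : R := height b2 ((set_val z : 'I_2 -> G) ord_max).

Lemma conf_coord_continuous (i : 'I_2) :
  continuous (fun z : Conf G 2 => (set_val z : 'I_2 -> G) i).
Proof.
move=> z; apply: (@continuous_comp _ _ _ set_val (fun g : {ptws 'I_2 -> G} => g i)).
  exact: continuous_set_val.
exact: continuous_eval.
Qed.

Lemma height1_continuous : continuous height1.
Proof.
move=> z; apply: (@continuous_comp _ _ _ (fun z : Conf G 2 => (set_val z : 'I_2 -> G) ord0)).
  exact: conf_coord_continuous.
exact: height_continuous.
Qed.

Lemma height2_continuous : continuous height2.
Proof.
move=> z; apply: (@continuous_comp _ _ _ (fun z : Conf G 2 => (set_val z : 'I_2 -> G) ord_max)).
  exact: conf_coord_continuous.
exact: height_continuous.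
Qed.

(** The map to the circle that sees the two points exchange at [v]: modulo 1
    it is nonzero only when the first point is in the branch of [b1] and the
    second one in the branch of [b2], and it runs from 0 to 1 while the first
    point leaves [v] and the second one approaches it. *)
Definition angle (z : Conf G 2) : R := height1 z / (height1 z + height2 z).

(** The heights can only vanish together at the boundary of both branches if
    both points are at [v], which is impossible in a configuration. *)
Lemma angle_mod1 : continuous_mod1 angle.
Proof.
apply: continuous_mod1_ratio.
- exact: height1_continuous.
- exact: height2_continuous.
- by move=> z; exact: height_ge0.
- by move=> z; exact: height_ge0.
move=> z z0 z1.
have [xv|xv] := pselect ((set_val z : 'I_2 -> G) ord0 = vertex R e v).
  right; apply: (conf_coord_continuous (height_near0 e2 _ z1)) => yv.
  by have /eqP := set_valP z ord0 ord_max (etrans xv (esym yv)).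
by left; apply: (conf_coord_continuous (height_near0 e1 xv z0)).
Qed.


(** Large enough to contain the first quarter of each edge at [a], and small
    enough to be disjoint from the other sets [near_vertex] and to leave room
    for other points in the middle of the edges. *)
Definition near_vertex (a : V) : set G := [set x : G | 3 / 4 <= set_val x a].

(** A vertex [w] other than [v] lies outside one of the two disjoint branches,
    whose height then vanishes all around [w]; this leaves only the values 0
    and 1 for [angle]. *)
Lemma angle_class_eq0 w : w != v ->
  pullback (conf_incl (near_vertex w) 2) (winding_class angle_mod1) = 0.
Proof.
move=> wv; apply: winding_class_eq0 => z.
pose y (i : 'I_2) : G := set_val (set_val z i).
have yw i : set_val (y i) w != 0.
  have : 3 / 4 <= set_val (y i) w by exact: (set_valP (set_val z i)).
  by move=> ?; apply: lt0r_neq0; lra.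
have [w1|w1] := boolP (branch b1 w); last first.
  exists 0; rewrite /angle (_ : height1 _ = 0) ?mul0r //.
  exact: height_eq0 e1 wv w1 (yw ord0).
have w2 : ~~ branch b2 w.
  by apply: contra b12 => w2; apply/eqP; exact: branch_disjoint e1 e2 w1 w2.
rewrite /angle (_ : height2 _ = 0) ?addr0; last exact: height_eq0 e2 wv w2 (yw ord_max).
have [->|h0] := eqVneq (height1 (conf_incl (near_vertex w) 2 z)) 0.
  by exists 0; rewrite mul0r.
by exists 1; rewrite divff.
Qed.

End Circle.

(** * Two points exchanging places around a vertex *)

Section Tripod.
Variables (b c : V).
Hypotheses (eb : e v b) (ec : e v c).

Definition tripod_coord (s t : R) (w : V) : R :=
  s * (w == b)%:R + t * (w == c)%:R + (1 - s - t) * (w == v)%:R.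

Lemma tripod_subproof s t : 0 <= s -> 0 <= t -> s + t <= 1 -> (s = 0) \/ (t = 0) ->
  tripod_coord s t \in @realization_set R V e.
Proof.
have sum1 a : \sum_w (w == a)%:R = 1 :> R.
  by rewrite (bigD1 a) //= eqxx big1 ?addr0 // => w /negbTE ->.
move=> s0 t0 st1 s0t0; apply/mem_set; split; first split.
- move=> w; rewrite /tripod_coord !addr_ge0 // mulr_ge0 ?ler0n //.
  by rewrite -addrA -opprD subr_ge0.
- rewrite /tripod_coord !big_split -!mulr_sumr /= !sum1; ring.
- case: s0t0 => [->|->].
  + exists c, v; split; first by right; rewrite tree_sym.
    move=> w; rewrite /tripod_coord mul0r add0r.
    by apply: contraNT; rewrite negb_or => /andP[/negbTE -> /negbTE ->]; rewrite !mulr0 addr0.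
  + exists b, v; split; first by right; rewrite tree_sym.
    move=> w; rewrite /tripod_coord mul0r addr0.
    by apply: contraNT; rewrite negb_or => /andP[/negbTE -> /negbTE ->]; rewrite !mulr0 addr0.
Qed.

(** The weights of [b] and [c] along the path from the point at height 1/4
    towards [b], through [v], to the point at height 1/4 towards [c]. *)
Definition down (u : R) : R := clamp (1 - 2 * u) / 4.
Definition up (u : R) : R := clamp (2 * u - 1) / 4.

Lemma clamp_le0 (u : R) : u <= 0 -> clamp u = 0.
Proof. by move=> u0; rewrite /clamp max_l // ge_min u0 orbT. Qed.

Lemma clamp_ge1 (u : R) : 1 <= u -> clamp u = 1.
Proof. by move=> u1; rewrite /clamp min_l // max_r. Qed.

Lemma down_bounds u : 0 <= down u <= 4^-1.
Proof. by rewrite /down; have /andP[? ?] := clamp_bounds (1 - 2 * u); lra. Qed.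

Lemma up_bounds u : 0 <= up u <= 4^-1.
Proof. by rewrite /up; have /andP[? ?] := clamp_bounds (2 * u - 1); lra. Qed.

Lemma down_up u : down u = 0 \/ up u = 0.
Proof.
rewrite /down /up; have [h|h] := leP (2 * u) 1; [right|left];
  by rewrite clamp_le0 ?mul0r //; lra.
Qed.

Lemma down0 : down 0 = 4^-1. Proof. by rewrite /down clamp_ge1 ?mul1r //; lra. Qed.
Lemma down1 : down 1 = 0. Proof. by rewrite /down clamp_le0 ?mul0r //; lra. Qed.
Lemma up0 : up 0 = 0. Proof. by rewrite /up clamp_le0 ?mul0r //; lra. Qed.
Lemma up1 : up 1 = 4^-1. Proof. by rewrite /up clamp_ge1 ?mul1r //; lra. Qed.

Lemma down_continuous : continuous down.
Proof.
apply: (@continuous_mul R R (fun u => clamp (1 - 2 * u)) (fun=> 4^-1)); last first.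
  exact: cst_continuous.
move=> u; apply: (@continuous_comp R R R (fun u : R => 1 - 2 * u) clamp); last first.
  exact: clamp_continuous.
apply: (@continuous_sub R R); first exact: cst_continuous.
by apply: (@continuous_mul R R) => [|x]; [exact: cst_continuous | exact: cvg_id].
Qed.

Lemma up_continuous : continuous up.
Proof.
apply: (@continuous_mul R R (fun u => clamp (2 * u - 1)) (fun=> 4^-1)); last first.
  exact: cst_continuous.
move=> u; apply: (@continuous_comp R R R (fun u : R => 2 * u - 1) clamp); last first.
  exact: clamp_continuous.
apply: (@continuous_sub R R); last exact: cst_continuous.
by apply: (@continuous_mul R R) => [|x]; [exact: cst_continuous | exact: cvg_id].
Qed.

Lemma travel_subproof u : tripod_coord (down u) (up u) \in @realization_set R V e.
Proof.
have /andP[? ?] := down_bounds u; have /andP[? ?] := up_bounds u.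
by apply: tripod_subproof => //; [lra | exact: down_up].
Qed.

Definition travel (u : R) : G :=
  exist (fun y => y \in @realization_set R V e) _ (travel_subproof u).

Lemma travelE u w : set_val (travel u) w = tripod_coord (down u) (up u) w.
Proof. by []. Qed.

Lemma travel_near u : travel u \in near_vertex v.
Proof.
apply/mem_set; rewrite /near_vertex /= travelE /tripod_coord eqxx.
rewrite eq_sym (negbTE (neighbour_neq eb)) eq_sym (negbTE (neighbour_neq ec)).
have := down_bounds u; have := up_bounds u; have [->|->] := down_up u;
  by rewrite ?mulr0n ?mulr1n => /andP[? ?] /andP[? ?]; lra.
Qed.

Definition traverse (u : R) : near_vertex v := exist _ (travel u) (travel_near u).

Lemma traverseE u w : set_val (set_val (traverse u)) w = tripod_coord (down u) (up u) w.
Proof. by []. Qed.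

Lemma traverse_continuous : continuous traverse.
Proof.
apply: continuous_to_subtype; apply: continuous_to_subtype; apply: continuous_to_prod => w.
rewrite -[X in continuous X]/(fun u => tripod_coord (down u) (up u) w).
have cd := down_continuous; have cu := up_continuous.
apply: (@continuous_add R R); last first.
  apply: (@continuous_mul R R); last exact: cst_continuous.
  apply: (@continuous_sub R R) => //; apply: (@continuous_sub R R) => //.
  exact: cst_continuous.
by apply: (@continuous_add R R); apply: (@continuous_mul R R) => //; exact: cst_continuous.
Qed.

Lemma height_traverse a u : e v a ->
  height a (set_val (traverse u)) = down u * (b == a)%:R + up u * (c == a)%:R.
Proof.
have sum1 d : \sum_(w | branch a w) (w == d)%:R = (branch a d)%:R :> R.
  rewrite big_mkcond (bigD1 d) //= eqxx big1 => [|w /negbTE ->]; last by case: ifP.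
  by rewrite addr0; case: (branch a d).
move=> ea; rewrite /height; under eq_bigr => w _ do rewrite traverseE /tripod_coord.
rewrite !big_split -!mulr_sumr /= !sum1 branch_v // !branch_eq //.
by rewrite mulr0 addr0 ![a == _]eq_sym.
Qed.

End Tripod.

Section Exchange.

Lemma traverse_start b c (eb : e v b) (ec : e v c) : traverse eb ec 0 = traverse eb eb 0.
Proof.
apply/set_val_inj/set_val_inj/funext => w.
by rewrite !traverseE /tripod_coord up0 !mul0r.
Qed.

Lemma traverse_end b c (eb : e v b) (ec : e v c) : traverse eb ec 1 = traverse ec ec 0.
Proof.
apply/set_val_inj/set_val_inj/funext => w.
by rewrite !traverseE /tripod_coord down1 up1 down0 up0 !mul0r add0r addr0 subr0 subr0.
Qed.

Section Stage.
Variables (i : 'I_2) (b c d : V).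
Hypotheses (eb : e v b) (ec : e v c) (ed : e v d) (bd : b != d) (cd : c != d).

Definition stage_fun (y : Delta R 'I_2) (k : 'I_2) : near_vertex v :=
  if k == i then traverse eb ec (set_val y ord_max) else traverse ed ed 0.

Lemma stage_subproof y :
  stage_fun y \in [set z : {ptws 'I_2 -> near_vertex v} | injective z].
Proof.
have apart u : traverse eb ec u <> traverse ed ed 0.
  move=> /(congr1 (fun x => set_val (set_val x) d)); rewrite !traverseE /tripod_coord.
  rewrite ![d == _]eq_sym eqxx (negbTE bd) (negbTE cd) down0 up0.
  rewrite [v == d]eq_sym (negbTE (neighbour_neq ed)) /= !mulr0 !mulr1 !addr0.
  by move=> /eqP; rewrite eq_sym invr_eq0 pnatr_eq0.
apply/mem_set => k l; rewrite /stage_fun.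
case: (eqVneq k i) (eqVneq l i) => [->|ki] [->|li] //.
- by move=> /apart.
- by move=> /esym /apart.
move=> _; apply/ord_inj; have := ltn_ord k; have := ltn_ord l.
have := ltn_ord i; move: ki li; rewrite -!val_eqE /=; lia.
Qed.

(** The [i]-th point moves from the arm [b] to the arm [c], while the other
    one rests on the arm [d]. *)
Definition stage_conf (y : Delta R 'I_2) : Conf (near_vertex v) 2 :=
  exist _ (stage_fun y) (stage_subproof y).

Lemma stage_continuous : continuous stage_conf.
Proof.
apply: continuous_to_subtype; apply: continuous_to_prod => k.
rewrite -[X in continuous X]/(fun y => stage_fun y k) /stage_fun.
case: (k == i); last exact: cst_continuous.
move=> y; apply: (@continuous_comp _ _ _
  (fun y : Delta R 'I_2 => set_val y ord_max) (traverse eb ec)).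
  exact: bary_continuous.
exact: traverse_continuous.
Qed.

Definition stage : sing R 1 (Conf (near_vertex v) 2) := mkcts stage_continuous.

Lemma stageE y k : set_val (stage y) k =
  if k == i then traverse eb ec (set_val y ord_max) else traverse ed ed 0.
Proof. by []. Qed.

End Stage.

(** After a point has moved from [b] to [c] while the other rested on [d], the
    other one may move away from [d]. *)
Lemma stage_meet (i j : 'I_2) b c d f (eb : e v b) (ec : e v c) (ed : e v d)
    (ef : e v f) (bd : b != d) (cd : c != d) (dc : d != c) (fc : f != c) :
  i != j -> target (stage i eb ec ed bd cd) = source (stage j ed ef ec dc fc).
Proof.
move=> ij; apply/continuousEP => y; apply/set_val_inj/funext => k.
rewrite /target /source /= -(seg1 y) -(seg0 y).
rewrite -[LHS]/(if k == i then traverse eb ec (clamp 1) else traverse ed ed 0).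
rewrite -[RHS]/(if k == j then traverse ed ef (clamp 0) else traverse ec ec 0).
rewrite clamp_ge1 // clamp_le0 // traverse_end traverse_start.
have : (k == i) = ~~ (k == j).
  have := ltn_ord k; have := ltn_ord i; have := ltn_ord j.
  by move: ij; rewrite -!val_eqE /=; lia.
by move=> ->; case: (k == j).
Qed.

Lemma rest_height a d (ed : e v d) : e v a ->
  height a (set_val (traverse ed ed 0)) = 4^-1 * (d == a)%:R.
Proof. by move=> ea; rewrite height_traverse // down0 up0 mul0r addr0. Qed.

(** Six alternating moves on the tripod with arms [b1], [b2], [b3] lead from the
    configuration [(b1, b2)] back to itself, the two points passing through
    [v] three times each; this is the generator of the fundamental group of
    the configurations of two points on the letter Y. On the first and the
    last move [angle] is continuous; on the next three ones the first point is
    outside the branch of [b1] and [angle] is zero; on the fifth one [angle]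
    jumps from 0 to 1 as the first point enters the branch of [b1] while the
    second one is outside the branch of [b2]. So the windings add up to -1,
    and the class is not a coboundary. *)
Lemma angle_class_neq0 b1 b2 b3 (e1 : e v b1) (e2 : e v b2) (e3 : e v b3) :
  b1 != b2 -> b2 != b3 -> b3 != b1 ->
  pullback (conf_incl (near_vertex v) 2) (winding_class (angle_mod1 e1 e2)) <> 0.
Proof.
move=> b12 b23 b31; have [b21 b32 b13] : [/\ b2 != b1, b3 != b2 & b1 != b3].
  by rewrite ![_ == b1]eq_sym [b3 == _]eq_sym; split=> //; rewrite eq_sym.
rewrite pullbackE => /cls_eq0 [beta E].
have {}E (s : sing R 1 (Conf (near_vertex v) 2)) :
    winding (angle_mod1 e1 e2) ((conf_incl (near_vertex v) 2 : _ -> _) \o s) =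
    beta (target s) - beta (source s).
  by rewrite -coboundary1E -E.
have i01 : (ord0 : 'I_2) != ord_max by [].
have i10 : (ord_max : 'I_2) != ord0 by [].
pose sA := stage ord0 e1 e3 e2 b12 b32.
pose sB := stage ord_max e2 e1 e3 b23 b13.
pose sC := stage ord0 e3 e2 e1 b31 b21.
pose sD := stage ord_max e1 e3 e2 b12 b32.
pose sE := stage ord0 e2 e1 e3 b23 b13.
pose sF := stage ord_max e3 e2 e1 b31 b21.
have AB : target sA = source sB by exact: stage_meet.
have BC : target sB = source sC by exact: stage_meet.
have CD : target sC = source sD by exact: stage_meet.
have DE : target sD = source sE by exact: stage_meet.
have EF : target sE = source sF by exact: stage_meet.
have FA : target sF = source sA by exact: stage_meet.
pose at_ (s : sing R 1 (Conf (near_vertex v) 2)) y (k : 'I_2) : G :=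
  set_val ((set_val (s y) : 'I_2 -> near_vertex v) k).
have angleE (s : sing R 1 (Conf (near_vertex v) 2)) y :
    angle b1 b2 (((conf_incl (near_vertex v) 2 : _ -> _) \o s) y) =
    height b1 (at_ s y ord0) / (height b1 (at_ s y ord0) + height b2 (at_ s y ord_max)).
  by [].
have eqs := (eqxx, negbTE b12, negbTE b23, negbTE b31, negbTE b21, negbTE b32,
  negbTE b13, mulr0, mulr1, addr0, add0r, mul0r).
pose t (y : Delta R 'I_2) := set_val y ord_max.
have ct : continuous t by exact: bary_continuous.
have cdown : continuous (fun y => down (t y)).
  by move=> y; apply: (@continuous_comp _ _ _ t down); [exact: ct | exact: down_continuous].
have c_up : continuous (fun y => up (t y)).
  by move=> y; apply: (@continuous_comp _ _ _ t up); [exact: ct | exact: up_continuous].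
have c4 : continuous (fun _ : Delta R 'I_2 => 4^-1 : R) by exact: cst_continuous.
have wA : winding (angle_mod1 e1 e2) ((conf_incl (near_vertex v) 2 : _ -> _) \o sA) = 0.
  apply: winding_continuous.
  rewrite (_ : (fun _ => _) = (fun y => down (t y) / (down (t y) + 4^-1))).
    apply: continuous_div => //; first exact: continuous_add.
    by move=> y; have /andP[? ?] := down_bounds (t y); apply: lt0r_neq0; lra.
  by apply/funext => y; rewrite angleE /at_ !stageE /= !rest_height // !height_traverse // !eqs.
have wB : winding (angle_mod1 e1 e2) ((conf_incl (near_vertex v) 2 : _ -> _) \o sB) = 0.
  rewrite (winding_integral _ (J := fun=> 0)) ?subrr // => y.
  by rewrite angleE /at_ !stageE /= rest_height // !eqs.
have wC : winding (angle_mod1 e1 e2) ((conf_incl (near_vertex v) 2 : _ -> _) \o sC) = 0.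
  rewrite (winding_integral _ (J := fun=> 0)) ?subrr // => y.
  by rewrite angleE /at_ !stageE /= height_traverse // !eqs.
have wD : winding (angle_mod1 e1 e2) ((conf_incl (near_vertex v) 2 : _ -> _) \o sD) = 0.
  rewrite (winding_integral _ (J := fun=> 0)) ?subrr // => y.
  by rewrite angleE /at_ !stageE /= rest_height // !eqs.
have wE : winding (angle_mod1 e1 e2) ((conf_incl (near_vertex v) 2 : _ -> _) \o sE) = -1.
  rewrite (winding_integral _ (J := fun y => (up (t y) != 0)%:R)) => [|y].
    by rewrite /t -[set_val (seg 0) _]/(clamp 0) -[set_val (seg 1) _]/(clamp 1)
      clamp_le0 // clamp_ge1 // up0 up1 eqxx invr_eq0 pnatr_eq0.
  rewrite angleE /at_ !stageE /= !rest_height // !height_traverse // !eqs -/(t y).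
  by have [->|u0] := eqVneq (up (t y)) 0; rewrite ?mul0r // divff.
have wF : winding (angle_mod1 e1 e2) ((conf_incl (near_vertex v) 2 : _ -> _) \o sF) = 0.
  apply: winding_continuous.
  rewrite (_ : (fun _ => _) = (fun y => 4^-1 / (4^-1 + up (t y)))).
    apply: continuous_div => //; first exact: continuous_add.
    by move=> y; have /andP[? ?] := up_bounds (t y); apply: lt0r_neq0; lra.
  by apply/funext => y; rewrite angleE /at_ !stageE /= !rest_height // !height_traverse // !eqs.
have := E sA; have := E sB; have := E sC; have := E sD; have := E sE; have := E sF.
rewrite wA wB wC wD wE wF AB BC CD DE EF FA.
move=> ? ? ? ? ? ?; lia.
Qed.

End Exchange.

End Star.

(** * The theorem *)

Lemma essential_class (R : realType) (V : finType) (e : rel V) (v : V) :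
  is_tree e -> essential e v ->
  exists alpha : cohomology R 1 (Conf (realization R e) 2),
    pullback (conf_incl (near_vertex v) 2) alpha <> 0 /\
    forall w, w != v -> pullback (conf_incl (near_vertex w) 2) alpha = 0.
Proof.
move=> e_tree /card_gt2P [b1 [b2 [b3 [[+ + +] [b12 b23 b31]]]]].
rewrite !inE => e1 e2 e3; exists (winding_class (angle_mod1 e_tree e1 e2)); split.
  exact: angle_class_neq0 e3 b12 b23 b31.
by move=> w wv; exact: angle_class_eq0.
Qed.

Lemma near_vertex_disjoint (R : realType) (V : finType) (e : rel V) (a b : V) :
  a != b -> near_vertex a `&` near_vertex b = set0 :> set (realization R e).
Proof.
move=> ab; apply/seteqP; split=> // x [/= xa xb].
have := realization_coord_sum x; rewrite (bigD1 a) //= (bigD1 b) 1?eq_sym //=.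
have : 0 <= \sum_(w | (w != a) && (w != b)) set_val x w.
  by apply: sumr_ge0 => w _; exact: realization_coord_ge0.
by move: xa xb; rewrite /near_vertex /=; lra.
Qed.

(** The points sit on the edge from [v] to [b], with weight
    [1/2 + 1/(k + 5) <= 7/10] at [v]. They serve as resting places for the
    points of a configuration beyond the first [2 m]. *)
Lemma far_points (R : realType) (V : finType) (e : rel V) (v b : V) :
  is_tree e -> e v b -> exists x : nat -> realization R e,
    injective x /\ forall a k, ~ near_vertex a (x k).
Proof.
move=> e_tree evb.
pose r (k : nat) : R := (k + 5)%:R^-1.
have r0 k : 0 < r k by rewrite invr_gt0 ltr0n addn_gt0 orbT.
have r1 k : r k <= 5^-1 by rewrite lef_pV2 ?posrE ?ltr0n ?addn_gt0 ?orbT // ler_nat leq_addl.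
have xP k : tripod_coord v b b (2^-1 - r k) 0 \in @realization_set R V e.
  by have := r0 k; have := r1 k => ? ?; apply: tripod_subproof => //; [lra | lra | right].
pose x k : realization R e := exist (fun y => y \in @realization_set R V e) _ (xP k).
have bv := neighbour_neq e_tree evb.
have xE k w : set_val (x k) w = (2^-1 - r k) * (w == b)%:R + (2^-1 + r k) * (w == v)%:R.
  rewrite -[LHS]/(tripod_coord v b b (2^-1 - r k) 0 w) /tripod_coord.
  by rewrite mul0r addr0; congr (_ + _ * _); lra.
exists x; split=> [k l /(congr1 (fun x => set_val x v))|a k].
  rewrite !xE eqxx eq_sym (negbTE bv) !mulr0 !mulr1 !add0r => /addrI /invr_inj /eqP.
  by rewrite eqr_nat eqn_add2r => /eqP.
rewrite /near_vertex /= xE; have := r0 k; have := r1 k.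
have [->|ab] := eqVneq a b; first by rewrite (negbTE bv) /= mulr0 mulr1 addr0; lra.
by case: (a == v); rewrite ?mulr0 ?mulr1; lra.
Qed.

Theorem corollary12p2 (R : realType) (V : finType) (e : rel V)
  (e_tree : is_tree e) (m : nat) (m_ge1 : (1 <= m)%N)
  (v : 'I_m -> V) (v_inj : injective v)
  (v_ess : forall a : V, essential e a <-> exists j, v j = a) :
  (forall (Y : 'I_m -> set (realization R e))
     (Y_at : forall j, is_Y_at (v j) (Y j))
     (Y_disj : forall i j, i != j -> Y i `&` Y j = set0)
     (alpha : 'I_m -> cohomology R 1 (Conf (realization R e) 2))
     (alpha_ne0 : forall j, pullback (conf_incl (Y j) 2) (alpha j) <> 0)
     (alpha_eq0 : forall i j, i != j ->
        pullback (conf_incl (Y i) 2) (alpha j) = 0),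
     let u (i j : 'I_m) : cohomology R 1 (Conf (realization R e) (2 * m)) :=
       pullback (Phi (realization R e) i) (alpha j) in
     Z_independent (fun s : 'S_m => cup_prod (fun i => u i (s i))))
  /\
  (forall n : nat, (2 * m <= n)%N ->
     rank_at_least (cohomology R m (Conf (realization R e) n)) m`!).
Proof.
case: m m_ge1 v v_inj v_ess => [//|m] _ v v_inj v_ess.
have pair_inj i j a b : @pair_index m.+1 i a = pair_index j b -> i = j.
  move=> /(congr1 val) /= E; apply/ord_inj.
  by have := ltn_ord a; have := ltn_ord b; lia.
have pair_surj k : exists i a, @pair_index m.+1 i a = k.
  have k2 : (k %/ 2 < m.+1)%N by have := ltn_ord k; lia.
  have km : (k %% 2 < 2)%N by rewrite ltn_pmod.
  exists (Ordinal k2), (Ordinal km); apply/ord_inj => /=; lia.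
have pair_on k : ~ forall i a, @pair_index m.+1 i a != k.
  by move=> h; have [i [a /eqP]] := pair_surj k; apply/negP.
split=> [Y Y_at Y_disj alpha alpha_ne0 alpha_eq0 u|n mn].
  (* Every label belongs to a pair, so the resting points can be arbitrary. *)
  have := @cup_products_independent R (realization R e) m _ _
    (@pair_index_inj m.+1) pair_inj Y Y_disj (fun=> vertex R e (v ord0)) _ _
    alpha alpha_ne0 alpha_eq0.
  by apply=> [k l /pair_on|i l /pair_on].
have ess j : essential e (v j) by apply/v_ess; exists j.
pose alpha j := sval (cid (essential_class R e_tree (ess j))).
have alphaP j : pullback (conf_incl (near_vertex (v j)) 2) (alpha j) <> 0 /\
    forall w, w != v j -> pullback (conf_incl (near_vertex w) 2) (alpha j) = 0.
  exact: (svalP (cid (essential_class R e_tree (ess j)))).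
have [x [x_inj x_far]] : exists x : nat -> realization R e,
    injective x /\ forall a k, ~ near_vertex a (x k).
  have /card_gt2P [b [_ [_ [[+ _ _] _]]]] := ess ord0.
  by rewrite inE; exact: far_points.
pose q i a := widen_ord mn (@pair_index m.+1 i a).
have q_inj i : injective (q i).
  by move=> a b /(congr1 val) /= E; apply: (@pair_index_inj _ i); exact/ord_inj.
have q_disj i j a b : q i a = q j b -> i = j.
  by move=> /(congr1 val) /= E; apply: (pair_inj _ _ a b); exact/ord_inj.
have := @cup_products_independent R (realization R e) m n q q_inj q_disj
  (fun j => near_vertex (v j)) _ (fun k => x k) _ _ alpha.
set u := fun s : 'S_m.+1 => _ => u_free.
have {}u_free : Z_independent u.
  apply: u_free.
  - by move=> i j ij; apply: near_vertex_disjoint; rewrite (inj_eq v_inj).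
  - by move=> k l _ _ /x_inj /ord_inj.
  - by move=> i l _; exact: x_far.
  - by move=> j; exact: (alphaP j).1.
  - by move=> i j ij; apply: (alphaP j).2; rewrite (inj_eq v_inj).
have card_perms : #|'S_m.+1| = m.+1`! by rewrite card_Sn.
pose p (k : 'I_(m.+1`!)) : 'S_m.+1 := enum_val (cast_ord (esym card_perms) k).
pose p' (s : 'S_m.+1) : 'I_(m.+1`!) := cast_ord card_perms (enum_rank s).
have pK : cancel p p' by move=> k; rewrite /p /p' enum_valK cast_ordKV.
have p'K : cancel p' p by move=> s; rewrite /p /p' cast_ordK enum_rankK.
exists (u \o p) => c uc0 k; rewrite -(pK k).
apply: (u_free (c \o p')); rewrite -[RHS]uc0 (reindex p) /=; last first.
  by apply: onW_bij; exists p'.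
by apply: eq_bigr => i _; rewrite /= pK.
Qed.
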